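(* Let $A$ be a C*-algebra that has two relatively diffuse commutative C*-subalgebras. Then any AW*-discretization $\phi \colon A \to M$ satisfies $M = 0$. Consequently, every functorial AW*-discretization $F \colon \mathbf{Cstar} \to \mathbf{AWstar}$ has $F(A) = 0$ for such $A$.
   Context: All algebras and subalgebras are unital and all homomorphisms preserve units (the zero algebra is allowed). $\mathbf{Cstar}$ is the category of C*-algebras with $*$-homomorphisms; $\mathbf{AWstar}$ is the category of AW*-algebras with $*$-homomorphisms whose restriction to the projection lattices preserves arbitrary least upper bounds. $\mathrm{Spec}(C)$ is the Gelfand spectrum of a commutative C*-algebra $C$; $\ell^\infty(X)$ is the algebra of bounded complex functions on a set $X$. An AW*-discretization of a C*-algebra $A$ is a homomorphism $\phi \colon A \to M$ to an AW*-algebra $M$ whose restriction to each commutative C*-subalgebra $C$ of $A$ factors through the natural inclusion $C \simeq C(\mathrm{Spec}(C)) \to \ell^\infty(\mathrm{Spec}(C))$ via a morphism $\phi_C \colon \ell^\infty(\mathrm{Spec}(C)) \to M$ in $\mathbf{AWstar}$. A functorial AW*-discretization is a functor $F \colon \mathbf{Cstar} \to \mathbf{AWstar}$ together with homomorphisms $\eta_A \colon A \to F(A)$, natural in $A$, such that there is an isomorphism $F(C) \simeq \ell^\infty(\mathrm{Spec}(C))$, natural in the commutative C*-algebra $C$, turning $\eta_C$ into the natural inclusion $C \to \ell^\infty(\mathrm{Spec}(C))$. An atom of a measure space $(X,\mu)$ is a measurable subset $U$ with $\mu(U) > 0$ such that for every measurable $V \subseteq U$, $\mu(V) < \mu(U)$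 implies $\mu(V) = 0$. A measure is diffuse if it has no atoms. A positive linear functional $\psi$ on a commutative C*-algebra $C(X)$, given by $\psi(f) = \int f \, d\mu$ for a regular Borel measure $\mu$ on $X$, is diffuse when $\mu$ is diffuse. A pair of commutative C*-subalgebras $C$ and $D$ of a C*-algebra $A$ is relatively diffuse when every extension of a pure state of $D$ to a state of $A$ restricts to a diffuse state on $C$. *)

(* Defs.v *)
From HB Require Import structures.
From mathcomp Require Import all_boot all_order all_algebra.
From mathcomp Require Import complex.
From mathcomp Require Import all_classical all_reals all_analysis.

Set Implicit Arguments.
Unset Strict Implicit.
Unset Printing Implicit Defensive.

Import Order.TTheory GRing.Theory Num.Theory.
Import numFieldNormedType.Exports.

Local Open Scope classical_set_scope.
Local Open Scope ring_scope.
Local Open Scope complex_scope.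

(* The multiplication is a field of the record, and the ring structure is
   recovered below, because Hierarchy Builder does not allow a structure
   joining rings and normed modules to be declared above [numDomainType].
   [1 = 0] is allowed, and norms take their values in [R[i]]. *)
Record cstarType (R : realType) := CstarType {
  cstar_module : completeNormedModType R[i];
  cstar_one : cstar_module;
  cstar_mul : cstar_module -> cstar_module -> cstar_module;
  cstar_star : cstar_module -> cstar_module;
  cstar_mulA : associative cstar_mul;
  cstar_mul1x : left_id cstar_one cstar_mul;
  cstar_mulx1 : right_id cstar_one cstar_mul;
  cstar_mulDl : left_distributive cstar_mul +%R;
  cstar_mulDr : right_distributive cstar_mul +%R;
  cstar_scaleAl : forall (k : R[i]) x y,
    k *: cstar_mul x y = cstar_mul (k *: x) y;
  cstar_scaleAr : forall (k : R[i]) x y,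
    k *: cstar_mul x y = cstar_mul x (k *: y);
  cstar_starK : involutive cstar_star;
  cstar_starD : {morph cstar_star : x y / x + y};
  cstar_starZ : forall (k : R[i]) x, cstar_star (k *: x) = k^* *: cstar_star x;
  cstar_starM : forall x y,
    cstar_star (cstar_mul x y) = cstar_mul (cstar_star y) (cstar_star x);
  cstar_normM : forall x y, `|cstar_mul x y| <= `|x| * `|y|;
  cstar_norm_star : forall x, `|cstar_mul (cstar_star x) x| = `|x| ^+ 2
}.

Definition cstar_sort (R : realType) (A : cstarType R) : Type := cstar_module A.
Coercion cstar_sort : cstarType >-> Sortclass.

HB.instance Definition _ (R : realType) (A : cstarType R) :=
  CompleteNormedModule.copy (cstar_sort A) (cstar_module A).

HB.instance Definition _ (R : realType) (A : cstarType R) :=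
  GRing.Zmodule_isPzRing.Build (cstar_sort A) (@cstar_mulA R A)
    (@cstar_mul1x R A) (@cstar_mulx1 R A) (@cstar_mulDl R A) (@cstar_mulDr R A).

Definition star (R : realType) (A : cstarType R) : A -> A := @cstar_star R A.

Definition cstar_commutative (R : realType) (A : cstarType R) : Prop :=
  commutative (@GRing.mul A).

Record starHom (R : realType) (A B : cstarType R) := StarHom {
  starHom_fun :> A -> B;
  starHom_linear : linear starHom_fun;
  starHom_monoid : monoid_morphism starHom_fun;
  starHom_star : {morph starHom_fun : x / star x >-> star x}
}.

Section StarHomCategory.
Variable R : realType.
Implicit Types A B C : cstarType R.

Definition starHom_id A : starHom A A.
Proof. by exists id. Defined.

Definition starHom_comp A B C (g : starHom B C) (f : starHom A B) :
  starHom A C.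
Proof.
exists (g \o f) => [k x y|| x] /=.
- by rewrite starHom_linear starHom_linear.
- split; first by rewrite /= !(starHom_monoid _).1.
  by move=> x y; rewrite /= !(starHom_monoid _).2.
- by rewrite !starHom_star.
Defined.

End StarHomCategory.

Section Projections.
Variables (R : realType) (A : cstarType R).
Implicit Types (p q : A) (S : set A).

Definition projection p : Prop := p * p = p /\ star p = p.

Definition proj_le p q : Prop := p * q = p.

Definition is_proj_lub S p : Prop :=
  [/\ S `<=` projection, projection p, forall s, S s -> proj_le s p
    & forall q, projection q -> (forall s, S s -> proj_le s q) -> proj_le p q].

Definition right_annihilator S : set A :=
  [set x | forall s, S s -> s * x = 0].

(* Kaplansky: an AW*-algebra is a C*-algebra that is a Baer *-ring. *)
Definition baer_star : Prop :=
  forall S, exists p,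
    projection p /\ right_annihilator S = [set p * x | x in [set: A]].

End Projections.

Record awstarType (R : realType) := AWstarType {
  aw_cstar :> cstarType R;
  aw_baer : baer_star aw_cstar
}.

Record awHom (R : realType) (M N : awstarType R) := AWHom {
  awHom_starHom :> starHom M N;
  awHom_lub : forall (S : set M) (p : M),
    is_proj_lub S p -> is_proj_lub (awHom_starHom @` S) (awHom_starHom p)
}.

Section ComplexComplete.
Variable R : realType.

Lemma Re_normK (z : R[i]) : (complex.Re `|z|)%:C = `|z|.
Proof. by rewrite RRe_real// normr_real. Qed.

Lemma normc_ge_Im (z : R[i]) : `|complex.Im z|%:C <= `|z|.
Proof.
have /eqP Ni : `|'i : R[i]| == 1.
  by rewrite normc_def/= expr0n expr1n add0r sqrtr1.
have := normc_ge_Re (z * 'i).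
by rewrite normrM Ni mulr1 ReiNIm normrN.
Qed.

Lemma normc_le_ReIm (z : R[i]) :
  `|z| <= `|complex.Re z|%:C + `|complex.Im z|%:C.
Proof.
have /eqP Ni : `|'i : R[i]| == 1.
  by rewrite normc_def/= expr0n expr1n add0r sqrtr1.
rewrite {1}(complexE z) (le_trans (ler_normD _ _))// normrM Ni mul1r.
have nC (r : R) : `|r%:C| = `|r|%:C :> R[i].
  by rewrite normc_def/= expr0n addr0 sqrtr_sqr.
by rewrite !nC.
Qed.

Lemma complex_complete (F : set_system R[i]^o) :
  ProperFilter F -> cauchy F -> exists l : R[i]^o, F --> l.
Proof.
move=> FF /cauchyP Fc.
have cvg_part (g : R[i] -> R) :
    (forall z w, `|g z - g w|%:C <= `|z - w|) -> cvg (g @ F).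
  move=> gle; apply/cauchy_cvgP/cauchyP => e e0.
  have /Fc[z Fz] : 0 < e%:C by rewrite ltcR.
  exists (g z); change (F (g @^-1` ball (g z) e)).
  apply: filterS Fz => w; rewrite /= -!ball_normE /ball_/= => zw.
  rewrite -ltcR; exact: (le_lt_trans (gle z w)).
have cRe : cvg (@complex.Re R @ F).
  apply: cvg_part => z w; rewrite -raddfB; exact: normc_ge_Re.
have cIm : cvg (@complex.Im R @ F).
  apply: cvg_part => z w; rewrite -raddfB; exact: normc_ge_Im.
set a := lim _ in cRe; set b := lim _ in cIm.
exists (a +i* b).
apply/(@cvgrPdist_lt _ _ _ F FF id) => e e0.
have ee : e = (complex.Re e)%:C by rewrite RRe_real// gtr0_real.
have e20 : 0 < complex.Re e / 2 by rewrite divr_gt0// -ltcR -ee.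
move/cvgrPdist_lt : cRe => /(_ _ e20) cRe.
move/cvgrPdist_lt : cIm => /(_ _ e20) cIm.
near=> z.
rewrite /= (le_lt_trans (normc_le_ReIm _))// ee (splitr (complex.Re e)).
rewrite rmorphD; apply: ltrD; rewrite ltcR.
- by rewrite raddfB/=; near: z.
- by rewrite raddfB/=; near: z.
Unshelve. all: by end_near. Qed.

End ComplexComplete.

Section LinfType.
Variables (R : realType) (X : Type).

Definition bounded_pred : {pred X -> R[i]} :=
  fun f => `[< exists M : R[i], forall x, `|f x| <= M >].

Record linf := Linf {
  linf_fun :> X -> R[i];
  linf_bounded : linf_fun \in bounded_pred
}.

HB.instance Definition _ := [isSub for linf_fun].
HB.instance Definition _ := [Choice of linf by <:].

Lemma bounded_submod : GRing.submod_closed bounded_pred.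
Proof.
split; first by apply/asboolP; exists 0 => x; rewrite normr0.
move=> k f g /asboolP[M fM] /asboolP[N gN]; apply/asboolP.
exists (`|k| * M + N) => x.
by rewrite (le_trans (ler_normD _ _))// lerD// normrM ler_wpM2l.
Qed.

HB.instance Definition _ :=
  GRing.isSubmodClosed.Build R[i] (X -> R[i]) bounded_pred bounded_submod.
HB.instance Definition _ := [SubChoice_isSubZmodule of linf by <:].
HB.instance Definition _ := [SubZmodule_isSubLmodule of linf by <:].


Lemma linfP (f g : linf) : f =1 g -> f = g.
Proof. by move=> fg; apply: val_inj; apply/funext. Qed.

Lemma linfDE (f g : linf) x : (f + g) x = f x + g x. Proof. by []. Qed.
Lemma linfNE (f : linf) x : (- f) x = - f x. Proof. by []. Qed.
Lemma linfZE k (f : linf) x : (k *: f) x = k * f x. Proof. by []. Qed.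
Lemma linf0E x : (0 : linf) x = 0. Proof. by []. Qed.

(* [sup set0 = 0], so this is also right when [X] is empty. *)
Definition linf_norm (f : linf) : R[i] :=
  (sup [set complex.Re `|f x| | x in [set: X]])%:C.

Lemma linf_norm_ub (f : linf) x : `|f x| <= linf_norm f.
Proof.
rewrite -Re_normK lecR; apply: ub_le_sup; last by exists x.
have /asboolP[M fM] := linf_bounded f.
exists (complex.Re M) => _ [y _ <-].
by have := fM y; rewrite lecE => /andP[].
Qed.

Lemma linf_norm_le (f : linf) (M : R[i]) :
  0 <= M -> (forall x, `|f x| <= M) -> linf_norm f <= M.
Proof.
move=> M0 fM.
have -> : M = (complex.Re M)%:C by rewrite RRe_real// ger0_real.
rewrite lecR.
have [->|S0] := eqVneq [set complex.Re `|f x| | x in [set: X]] set0.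
  by rewrite sup0; move: M0; rewrite lecE => /andP[].
apply: ge_sup; first exact/set0P.
by move=> _ [y _ <-]; have := fM y; rewrite lecE => /andP[].
Qed.

Lemma linf_norm_ge0 (f : linf) : 0 <= linf_norm f.
Proof.
rewrite ler0c.
have [->|] := eqVneq [set complex.Re `|f x| | x in [set: X]] set0.
  by rewrite sup0.
move=> /set0P[_ [x _ _]]; rewrite -ler0c.
exact: le_trans (linf_norm_ub f x).
Qed.

Lemma linf_normD (f g : linf) : linf_norm (f + g) <= linf_norm f + linf_norm g.
Proof.
apply: linf_norm_le => [|x]; first by rewrite addr_ge0// linf_norm_ge0.
by rewrite linfDE (le_trans (ler_normD _ _))// lerD// linf_norm_ub.
Qed.

Lemma linf_normZ (k : R[i]) (f : linf) : linf_norm (k *: f) = `|k| * linf_norm f.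
Proof.
have le1 c (g : linf) : linf_norm (c *: g) <= `|c| * linf_norm g.
  apply: linf_norm_le => [|x]; first by rewrite mulr_ge0// linf_norm_ge0.
  by rewrite linfZE normrM ler_wpM2l// linf_norm_ub.
apply/eqP; rewrite eq_le le1/=.
have [->|k0] := eqVneq k 0; first by rewrite normr0 mul0r linf_norm_ge0.
rewrite -{1}[f](scalerK k0) -ler_pdivlMl ?normr_gt0//.
by rewrite -normfV le1.
Qed.

Lemma linf_norm0_eq0 (f : linf) : linf_norm f = 0 -> f = 0.
Proof.
move=> f0; apply: linfP => x; apply/eqP; rewrite linf0E -normr_eq0.
by rewrite eq_le normr_ge0 andbT -f0 linf_norm_ub.
Qed.

HB.instance Definition _ := Lmodule_isNormed.Build R[i] linf
  linf_normD linf_normZ linf_norm0_eq0.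

Lemma linf_complete (F : set_system linf) :
  ProperFilter F -> cauchy F -> cvg F.
Proof.
move=> FF /cauchyP Fc.
have /choice[g Fg] x : exists l : R[i]^o, (fun f : linf => f x : R[i]^o) @ F --> l.
  apply: complex_complete; apply/cauchyP => e /Fc[f Ff].
  exists (f x).
  change (F ((fun f : linf => f x : R[i]^o) @^-1` ball (f x : R[i]^o) e)).
  apply: filterS Ff => h; rewrite /= -!ball_normE /ball_/= => fh.
  exact: le_lt_trans (linf_norm_ub (f - h) x) fh.
have ballg f e x : 0 < e -> F (ball f e) -> `|f x - g x| <= e + e.
  move=> e0 Ff; have /cvgrPdist_lt/(_ _ e0) gx := Fg x.
  have {}Ff : \forall h \near F, `|f - h| < e.
    by apply: filterS Ff => h; rewrite -ball_normE.
  near F => h.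
  have fh : `|f - h| < e by near: h.
  have gh : `|g x - h x| < e by near: h.
  rewrite -(subrKA (h x)) (le_trans (ler_normD _ _))// lerD//.
    by apply: ltW; apply: le_lt_trans (linf_norm_ub (f - h) x) fh.
  by rewrite distrC ltW.
have gP : g \in bounded_pred.
  have [f Ff] := Fc 1 ltr01; apply/asboolP; exists (linf_norm f + (1 + 1)) => x.
  rewrite -[g x](subKr (f x)) (le_trans (ler_normB _ _))// lerD//.
    exact: linf_norm_ub.
  exact: ballg.
apply/cvg_ex; exists (Linf gP); apply/(@cvgrPdist_lt _ _ _ F FF id) => e e0.
pose d := e / 2 / 2; have d0 : 0 < d by rewrite !divr_gt0.
have eE : e = d + d + (d + d) by rewrite -!splitr.
have [f Ff] := Fc _ d0; apply: filterS (Ff) => h.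
rewrite -ball_normE/= => fh.
rewrite -(subrKA f) (le_lt_trans (ler_normD _ _))//.
have gf : `|Linf gP - f| <= d + d.
  apply: linf_norm_le => [|x]; first by rewrite addr_ge0// ltW.
  by rewrite linfDE linfNE distrC; exact: ballg.
by apply: (lt_trans (ler_ltD gf fh)); rewrite eE addrA ltrDl.
Unshelve. all: by end_near. Qed.

HB.instance Definition _ := Uniform_isComplete.Build linf linf_complete.

Let one_bounded : (fun=> 1) \in bounded_pred.
Proof. by apply/asboolP; exists 1 => x; rewrite normr1. Qed.

Let mul_bounded (f g : linf) : (fun x => f x * g x) \in bounded_pred.
Proof.
apply/asboolP; exists (linf_norm f * linf_norm g) => x.
by rewrite normrM ler_pM// linf_norm_ub.
Qed.

Let conj_bounded (f : linf) : (fun x => (f x)^*) \in bounded_pred.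
Proof.
apply/asboolP; exists (linf_norm f) => x.
by rewrite normcJ linf_norm_ub.
Qed.

Definition linf_one : linf := Linf one_bounded.
Definition linf_mul (f g : linf) : linf := Linf (mul_bounded f g).
Definition linf_star (f : linf) : linf := Linf (conj_bounded f).

Let normM (f g : linf) : `|linf_mul f g| <= `|f| * `|g|.
Proof.
apply: linf_norm_le => [|x]; first by rewrite mulr_ge0.
by rewrite normrM ler_pM// linf_norm_ub.
Qed.

Let norm_star (f : linf) : `|linf_mul (linf_star f) f| = `|f| ^+ 2.
Proof.
apply/eqP; rewrite eq_le; apply/andP; split.
  apply: (le_trans (normM _ _)); rewrite expr2 ler_wpM2r//.
  by apply: linf_norm_le => // x; rewrite normcJ linf_norm_ub.
set N := `|linf_mul _ _|; have N0 : 0 <= N by exact: normr_ge0.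
have -> : N = sqrtC N ^+ 2 by rewrite sqrtCK.
rewrite ler_pXn2r// ?nnegrE ?sqrtC_ge0//.
apply: linf_norm_le => [|x]; first by rewrite sqrtC_ge0.
rewrite -(@ler_pXn2r _ 2)// ?nnegrE ?sqrtC_ge0// sqrtCK.
have := linf_norm_ub (linf_mul (linf_star f) f) x.
by rewrite normrM normcJ -expr2.
Qed.

Let mulA : associative linf_mul.
Proof. by move=> f g h; apply: linfP => x; exact: mulrA. Qed.
Let mul1x : left_id linf_one linf_mul.
Proof. by move=> f; apply: linfP => x; exact: mul1r. Qed.
Let mulx1 : right_id linf_one linf_mul.
Proof. by move=> f; apply: linfP => x; exact: mulr1. Qed.
Let mulDl : left_distributive linf_mul +%R.
Proof. by move=> f g h; apply: linfP => x; exact: mulrDl. Qed.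
Let mulDr : right_distributive linf_mul +%R.
Proof. by move=> f g h; apply: linfP => x; exact: mulrDr. Qed.
Let scaleAl (k : R[i]) (f g : linf) : k *: linf_mul f g = linf_mul (k *: f) g.
Proof. by apply: linfP => x; exact: mulrA. Qed.
Let scaleAr (k : R[i]) (f g : linf) : k *: linf_mul f g = linf_mul f (k *: g).
Proof. by apply: linfP => x; exact: mulrCA. Qed.
Let starK : involutive linf_star.
Proof. by move=> f; apply: linfP => x; exact: conjcK. Qed.
Let starD : {morph linf_star : f g / f + g}.
Proof. by move=> f g; apply: linfP => x; exact: rmorphD. Qed.
Let starZ (k : R[i]) (f : linf) : linf_star (k *: f) = k^* *: linf_star f.
Proof. by apply: linfP => x; exact: rmorphM. Qed.
Let starM (f g : linf) :
  linf_star (linf_mul f g) = linf_mul (linf_star g) (linf_star f).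
Proof. by apply: linfP => x; rewrite /= mulrC rmorphM. Qed.

Definition linf_cstar : cstarType R :=
  CstarType mulA mul1x mulx1 mulDl mulDr scaleAl scaleAr starK starD starZ
    starM normM norm_star.

Lemma linf_baer : baer_star linf_cstar.
Proof.
move=> S; pose Z x := `[< forall s : linf, S s -> s x = 0 >].
have pb : (fun x => (Z x)%:R) \in bounded_pred.
  by apply/asboolP; exists 1 => x; case: (Z x); rewrite ?normr1 ?normr0.
exists (Linf pb); split; first split.
- apply: (@linfP (linf_mul (Linf pb) (Linf pb))) => x /=.
  by case: (Z x); rewrite ?mulr1 ?mulr0.
- by apply: (@linfP (linf_star (Linf pb))) => x /=; case: (Z x); rewrite ?conjc1 ?conjc0.
rewrite eqEsubset; split=> [f /= Sf|_ [f _ <-] s Ss].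
  exists f => //; apply: (@linfP (linf_mul (Linf pb) f)) => x /=.
  rewrite /Z; case: asboolP => [_|/= nZ].
    exact: mul1r.
  apply/esym; rewrite mul0r; apply: contrapT => fx; apply: nZ => s Ss.
  have /(congr1 (fun h : linf => h x)) /eqP := Sf _ Ss.
  by rewrite /= mulf_eq0 => /orP[/eqP//|/eqP/fx].
apply: (@linfP (linf_mul s (linf_mul (Linf pb) f)) 0) => x /=.
rewrite /Z; case: asboolP => [/(_ _ Ss) ->|_]; first by rewrite mul0r.
by rewrite mul0r mulr0.
Qed.

Definition linf_aw : awstarType R := AWstarType linf_baer.

End LinfType.

Record csubalg (R : realType) (A : cstarType R) := CSubalg {
  csub_set : set A;
  csub_one : csub_set 1;
  csub_lin : forall (k : R[i]) x y,
    csub_set x -> csub_set y -> csub_set (k *: x + y);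
  csub_mul : forall x y, csub_set x -> csub_set y -> csub_set (x * y);
  csub_star : forall x, csub_set x -> csub_set (star x);
  csub_closed : closed csub_set
}.

Section CSubalgType.
Variables (R : realType) (A : cstarType R) (S : csubalg A).

Definition csub_pred : {pred A} := fun x => `[< csub_set S x >].

Record csub := CSub { csub_val : A; csub_valP : csub_val \in csub_pred }.

HB.instance Definition _ := [isSub for csub_val].
HB.instance Definition _ := [Choice of csub by <:].

Lemma csub_submod : GRing.submod_closed csub_pred.
Proof.
split; last first.
  by move=> k x y /asboolP Sx /asboolP Sy; apply/asboolP; exact: csub_lin.
apply/asboolP; have S1 := csub_one S.
by have := csub_lin (-1) S1 S1; rewrite scaleN1r addNr.
Qed.

HB.instance Definition _ :=
  GRing.isSubmodClosed.Build R[i] (cstar_sort A) csub_pred csub_submod.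
HB.instance Definition _ := [SubChoice_isSubZmodule of csub by <:].
HB.instance Definition _ := [SubZmodule_isSubLmodule of csub by <:].

Definition csub_norm (x : csub) : R[i] := `|csub_val x|.

Let csub_normD (x y : csub) : csub_norm (x + y) <= csub_norm x + csub_norm y.
Proof. exact: ler_normD. Qed.

Let csub_normZ (k : R[i]) (x : csub) : csub_norm (k *: x) = `|k| * csub_norm x.
Proof. exact: normrZ. Qed.

Let csub_norm0_eq0 (x : csub) : csub_norm x = 0 -> x = 0.
Proof. by move=> /normr0_eq0 x0; exact: val_inj. Qed.

HB.instance Definition _ := Lmodule_isNormed.Build R[i] csub
  csub_normD csub_normZ csub_norm0_eq0.

Lemma csub_complete (F : set_system csub) :
  ProperFilter F -> cauchy F -> cvg F.
Proof.
move=> FF /cauchyP Fc.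
have : cvg (csub_val @ F).
  apply/cauchy_cvgP/cauchyP => e /Fc[x Fx]; exists (csub_val x).
  change (F (csub_val @^-1` ball (csub_val x) e)).
  by apply: filterS Fx => y; rewrite /= -!ball_normE.
move=> /cvg_ex[l Fl].
have Sl : csub_set S l.
  have SF : \forall x \near F, csub_set S (csub_val x).
    by apply: nearW => x; exact/asboolP/csub_valP.
  exact: (closed_cvg _ (@csub_closed _ _ S) SF _ Fl).
have lS : l \in csub_pred by exact/asboolP.
apply/cvg_ex; exists (CSub lS).
apply/(@cvgrPdist_lt _ _ _ F FF id) => e e0.
by move/cvgrPdist_lt : Fl => /(_ _ e0).
Qed.

HB.instance Definition _ := Uniform_isComplete.Build csub csub_complete.

Let one_in : 1 \in csub_pred.
Proof. exact/asboolP/csub_one. Qed.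
Let mul_in (x y : csub) : csub_val x * csub_val y \in csub_pred.
Proof.
by apply/asboolP/csub_mul; apply/asboolP; exact: csub_valP.
Qed.
Let star_in (x : csub) : star (csub_val x) \in csub_pred.
Proof. by apply/asboolP/csub_star/asboolP; exact: csub_valP. Qed.

Let one : csub := CSub one_in.
Let mul (x y : csub) : csub := CSub (mul_in x y).
Let sstar (x : csub) : csub := CSub (star_in x).

Let mulA : associative mul.
Proof. by move=> x y z; apply: val_inj; exact: mulrA. Qed.
Let mul1x : left_id one mul.
Proof. by move=> x; apply: val_inj; exact: mul1r. Qed.
Let mulx1 : right_id one mul.
Proof. by move=> x; apply: val_inj; exact: mulr1. Qed.
Let mulDl : left_distributive mul +%R.
Proof. by move=> x y z; apply: val_inj; exact: mulrDl. Qed.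
Let mulDr : right_distributive mul +%R.
Proof. by move=> x y z; apply: val_inj; exact: mulrDr. Qed.
Let scaleAl (k : R[i]) (x y : csub) : k *: mul x y = mul (k *: x) y.
Proof. by apply: val_inj; exact: cstar_scaleAl. Qed.
Let scaleAr (k : R[i]) (x y : csub) : k *: mul x y = mul x (k *: y).
Proof. by apply: val_inj; exact: cstar_scaleAr. Qed.
Let starK : involutive sstar.
Proof. by move=> x; apply: val_inj; exact: cstar_starK. Qed.
Let starD : {morph sstar : x y / x + y}.
Proof. by move=> x y; apply: val_inj; exact: cstar_starD. Qed.
Let starZ (k : R[i]) (x : csub) : sstar (k *: x) = k^* *: sstar x.
Proof. by apply: val_inj; exact: cstar_starZ. Qed.
Let starM (x y : csub) : sstar (mul x y) = mul (sstar y) (sstar x).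
Proof. by apply: val_inj; exact: cstar_starM. Qed.
Let normM (x y : csub) : `|mul x y| <= `|x| * `|y|.
Proof. exact: cstar_normM. Qed.
Let norm_star (x : csub) : `|mul (sstar x) x| = `|x| ^+ 2.
Proof. exact: cstar_norm_star. Qed.

Definition csub_cstar : cstarType R :=
  CstarType mulA mul1x mulx1 mulDl mulDr scaleAl scaleAr starK starD starZ
    starM normM norm_star.

Definition csub_incl : starHom csub_cstar A.
Proof. by exists csub_val. Defined.

End CSubalgType.

Coercion csub_cstar : csubalg >-> cstarType.

Section Spectrum.
Variables (R : realType) (A : cstarType R).

Record spec := Spec {
  spec_fun :> A -> R[i];
  spec_scalar : scalar spec_fun;
  spec_monoid : monoid_morphism spec_fun
}.

HB.instance Definition _ := gen_eqMixin spec.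
HB.instance Definition _ := gen_choiceMixin spec.

(* The weak-* topology, that is, pointwise convergence. *)
HB.instance Definition _ := Topological.copy spec
  (initial_topology (fun x : spec => (x : A -> R[i]) : {ptws A -> R[i]^o})).

Lemma quasi_inverse (b : A) : `|b| < 1 -> exists y, y = b + b * y.
Proof.
move=> b1; set r := `|b| in b1; have r0 : 0 <= r by exact: normr_ge0.
have r1 : 0 < 1 - r by rewrite subr_gt0.
pose s n : A := \sum_(k < n) b ^+ k.+1.
have sS n : s n.+1 = b + b * s n.
  by rewrite /s big_ord_recl expr1 mulr_sumr.
have normX n : `|b ^+ n.+1| <= r ^+ n.+1.
  elim: n => [|n IH]; first by rewrite !expr1.
  rewrite exprS [leRHS]exprS; apply: (le_trans (cstar_normM _ _)).
  by rewrite ler_wpM2l.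
have tail N m : `|s (N + m)%N - s N| * (1 - r) <= r ^+ N - r ^+ (N + m).
  elim: m => [|m IH]; first by rewrite addn0 !subrr normr0 mul0r.
  rewrite addnS {1}/s big_ord_recr/= -/(s (N + m)%N) addrAC.
  apply: (le_trans (ler_wpM2r (ltW r1) (ler_normD _ _))).
  rewrite mulrDl -[leRHS](subrKA (r ^+ (N + m))) lerD//.
  have -> : r ^+ (N + m) - r ^+ (N + m).+1 = r ^+ (N + m) * (1 - r).
    by rewrite mulrBr mulr1 -exprSr.
  rewrite ler_wpM2r ?(ltW r1)//; apply: (le_trans (normX _)).
  by rewrite exprS ler_piMl ?exprn_ge0// ltW.
have : cvg (s @ \oo).
  apply/cauchy_cvgP/cauchyP => e e0.
  have rE : r = (complex.Re r)%:C by rewrite RRe_real ?ger0_real.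
  have Rr1 : `|complex.Re r| < 1.
    by rewrite ger0_norm -?ltcR -?lecR -?rE.
  have e10 : 0 < complex.Re (e * (1 - r)).
    by rewrite -ltcR RRe_real ?mulr_gt0// gtr0_real// mulr_gt0.
  have /cvgrPdist_lt/(_ _ e10)[N _ rN] := cvg_expr Rr1.
  exists (s N); change (\forall n \near \oo, ball (s N) e (s n)).
  near=> n; rewrite -ball_normE /ball_/= distrC.
  have Nn : (N <= n)%N by near: n; exact: nbhs_infty_ge.
  rewrite -(subnKC Nn) -(ltr_pM2r r1); apply: (le_lt_trans (tail _ _)).
  apply: (@le_lt_trans _ _ (r ^+ N)); first by rewrite lerBlDr lerDl exprn_ge0.
  have := rN N (leqnn N); rewrite /= sub0r normrN -ltcR.
  rewrite ger0_norm ?exprn_ge0 -?lecR -?rE//.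
  have -> : (complex.Re r ^+ N)%:C = r ^+ N by rewrite [in RHS]rE rmorphXn.
  by rewrite RRe_real// gtr0_real// mulr_gt0.
move=> /cvg_ex[l sl]; exists l.
apply/eqP; rewrite -subr_eq0 -normr_eq0; apply: contraT => D0.
set D := `|_ - _| in D0; have Dp : 0 < D by rewrite lt_def D0 normr_ge0.
have D2 : 0 < D / 2 by rewrite divr_gt0.
have /cvgrPdist_lt/(_ _ D2)[N _ slN] := sl.
suff : D < D / 2 + D / 2 by rewrite -splitr ltxx.
rewrite {1}/D -[in ltLHS](subrKA (s N.+1)) (le_lt_trans (ler_normD _ _))//.
apply: ltr_leD; first exact: (slN N.+1 (leqnSn N)).
rewrite sS opprD addrACA subrr add0r -mulrBr.
apply: (le_trans (cstar_normM _ _)); rewrite -/r -[leRHS]mul1r.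
apply: ler_pM => //; first exact: ltW.
by rewrite -normrN opprB; apply: ltW; exact: (slN N (leqnn N)).
Unshelve. all: by end_near. Qed.

Lemma spec_norm_le (x : spec) (a : A) : `|x a| <= `|a|.
Proof.
rewrite real_leNgt ?normr_real//; apply/negP => axa.
have xa0 : x a != 0 by rewrite -normr_gt0 (le_lt_trans _ axa).
have xZ k c : x (k *: c) = k * x c.
  have x0 : x 0 = 0.
    by have := spec_scalar x (-1) 0 0; rewrite scaler0 addr0 mulN1r addNr.
  by have := spec_scalar x k c 0; rewrite !addr0 x0 addr0.
have xD c d : x (c + d) = x c + x d.
  by have := spec_scalar x 1 c d; rewrite scale1r mul1r.
have [|y] := @quasi_inverse ((x a)^-1 *: a).
  by rewrite normrZ normfV mulrC ltr_pdivrMr ?normr_gt0// mul1r.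
move=> /(congr1 x); rewrite xD (spec_monoid x).2 !xZ mulVf// mul1r.
by move=> /eqP; rewrite eq_sym -subr_eq0 addrK oner_eq0.
Qed.

Let gelfand_bounded (a : A) : (fun x : spec => x a) \in @bounded_pred R spec.
Proof. by apply/asboolP; exists `|a| => x; exact: spec_norm_le. Qed.

Definition gelfand (a : A) : linf R spec := Linf (gelfand_bounded a).

End Spectrum.

Section SpectrumMap.
Variables (R : realType) (A B : cstarType R) (f : starHom A B).

Definition spec_map (y : spec B) : spec A.
Proof.
exists (y \o f) => [k a b|] /=.
- by rewrite starHom_linear spec_scalar.
- split; first by rewrite /= (starHom_monoid f).1 (spec_monoid y).1.
  by move=> a b; rewrite /= (starHom_monoid f).2 (spec_monoid y).2.
Defined.

End SpectrumMap.

Section LinfPull.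
Variables (R : realType) (X Y : Type) (g : Y -> X) (f : linf R X).

Let pull_bounded : f \o g \in @bounded_pred R Y.
Proof. by apply/asboolP; exists `|f| => y; exact: linf_norm_ub. Qed.

Definition linf_pull : linf R Y := Linf pull_bounded.

End LinfPull.

Section Discretization.
Variable R : realType.

(* The spectrum of a subalgebra [C] is that of [C] as a C*-algebra in itself. *)
Definition aw_discretization (A : cstarType R) (M : awstarType R)
    (phi : starHom A M) : Prop :=
  forall C : csubalg A, cstar_commutative C ->
    exists phiC : awHom (linf_aw R (spec C)) M,
      forall c : C, phi (csub_incl C c) = phiC (gelfand c).

Record cstar_aw_functor := CstarAWFunctor {
  fobj :> cstarType R -> awstarType R;
  fmap_hom : forall A B : cstarType R, starHom A B -> awHom (fobj A) (fobj B);
  fmap_id : forall A (x : fobj A), fmap_hom (starHom_id A) x = x;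
  fmap_comp : forall A B C (g : starHom B C) (f : starHom A B) (x : fobj A),
    fmap_hom (starHom_comp g f) x = fmap_hom g (fmap_hom f x)
}.

Definition natural_unit (F : cstar_aw_functor)
    (eta : forall A, starHom A (F A)) : Prop :=
  forall A B (f : starHom A B) (a : A), eta B (f a) = fmap_hom F f (eta A a).

(* [u] is the natural isomorphism from [F C] to the bounded functions on the
   spectrum of [C], with inverse [v]. *)
Definition functorial_aw_discretization (F : cstar_aw_functor)
    (eta : forall A, starHom A (F A)) : Prop :=
  natural_unit eta /\
  exists (u : forall C : cstarType R, cstar_commutative C ->
                awHom (F C) (linf_aw R (spec C)))
         (v : forall C : cstarType R, cstar_commutative C ->
                awHom (linf_aw R (spec C)) (F C)),
  [/\ forall C (hC : cstar_commutative C), cancel (u C hC) (v C hC),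
      forall C (hC : cstar_commutative C), cancel (v C hC) (u C hC),
      forall C D (hC : cstar_commutative C) (hD : cstar_commutative D)
        (f : starHom C D) (x : F C),
        u D hD (fmap_hom F f x) = linf_pull (spec_map f) (u C hC x)
    & forall C (hC : cstar_commutative C) (c : C),
        u C hC (eta C c) = gelfand c].

End Discretization.

Section States.
Variables (R : realType) (A : cstarType R).

Definition is_state (f : A -> R[i]) : Prop :=
  [/\ scalar f, forall a, 0 <= f (star a * a) & f 1 = 1].

Definition is_pure_state (f : A -> R[i]) : Prop :=
  is_state f /\
  forall (g h : A -> R[i]) (t : R), is_state g -> is_state h -> 0 < t < 1 ->
    (forall a, f a = t%:C * g a + (1 - t)%:C * h a) -> g =1 f /\ h =1 f.

End States.

Section MeasureAtoms.
Context d (T : measurableType d) (R : realType).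
Variable mu : {measure set T -> \bar R}.

Definition is_atom (U : set T) : Prop :=
  [/\ measurable U, (0 < mu U)%E
    & forall V, measurable V -> V `<=` U -> (mu V < mu U)%E -> mu V = 0%E].

Definition diffuse_measure : Prop := forall U, ~ is_atom U.

Definition complex_integral (f : T -> R[i]) : R[i] :=
  (\int[mu]_x complex.Re (f x)) +i* (\int[mu]_x complex.Im (f x)).

End MeasureAtoms.

Section BorelSpectrum.
Variables (R : realType) (A : cstarType R).

(* [measurableType] requires a base point, so the Borel space of the spectrum
   depends on the choice of a point [x0]; its sigma-algebra does not. *)
Definition pointed_spec (x0 : spec A) : Type := spec A.

HB.instance Definition _ (x0 : spec A) := Topological.on (pointed_spec x0).
HB.instance Definition _ (x0 : spec A) := isPointed.Build (pointed_spec x0) x0.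

Definition borel_spec (x0 : spec A) :=
  g_sigma_algebraType (@open (pointed_spec x0)).

(* The spectrum is compact, so its regular Borel measures are finite. *)
Definition regular_measure (x0 : spec A)
    (mu : {finite_measure set (borel_spec x0) -> \bar R}) : Prop :=
  forall E : set (borel_spec x0), measurable E ->
    mu E = ereal_inf [set mu U | U in
             [set U : set (spec A) | open U /\ E `<=` U]] /\
    mu E = ereal_sup [set mu K | K in
             [set K : set (spec A) | compact K /\ K `<=` E]].

(* For commutative [A]. If the spectrum is empty, [A] is 0 and its only functional
   is given by the zero measure, which is diffuse. *)
Definition diffuse_functional (psi : A -> R[i]) : Prop :=
  forall x0 : spec A,
    exists mu : {finite_measure set (borel_spec x0) -> \bar R},
      [/\ regular_measure mu, diffuse_measure mu
        & forall a, psi a = complex_integral mu (fun x => (x : spec A) a)].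

End BorelSpectrum.

Definition relatively_diffuse (R : realType) (A : cstarType R)
    (C D : csubalg A) : Prop :=
  forall rho : D -> R[i], is_pure_state rho ->
  forall psi : A -> R[i], is_state psi ->
    (forall d : D, psi (csub_incl D d) = rho d) ->
    diffuse_functional (fun c : C => psi (csub_incl C c)).

(* Main.v *)
(* Let [delta_x], [delta_y] be the point masses in the bounded functions on
   [Spec C], [Spec D], and let [q], [p] be their images in [M]. If [q p <> 0], some
   state [s] of [M] has [s(p q p) > 0], and [psi(a) = s(p phi(a) p) / s(p)] is a
   state of [A] extending the character [y] of [D], which is a pure state. Hence
   [psi] restricts to a diffuse measure on [Spec C], so there are positive [f] in
   [C] with [f(x) = 1] and [psi(f)] arbitrarily small; but
   [s(p q p) <= s(p) psi(f)]. So [q p = 0] for all [x] and [y]. Since the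
   [delta_x] have least upper bound 1, and likewise the [delta_y], first [p = 0]
   and then [1 = 0].
   States of [M] are obtained from the Hahn-Banach theorem; their positivity rests
   on the theorem of Fukamiya and Kaplansky that [a^* a] is positive, which follows
   without spectral theory from square roots and norm estimates. *)

Require Import Defs.
From mathcomp Require Import all_boot all_order all_algebra.
From mathcomp Require Import complex.
From mathcomp Require Import all_classical all_reals all_analysis.
From mathcomp Require Import measurable_realfun.
From mathcomp Require Import ring lra.

Set Implicit Arguments.
Unset Strict Implicit.
Unset Printing Implicit Defensive.

Import Order.TTheory GRing.Theory Num.Theory.
Import numFieldNormedType.Exports.

Local Open Scope classical_set_scope.
Local Open Scope ring_scope.
Local Open Scope complex_scope.

(** * C*-algebras *)

Lemma real_complexD (R : realType) (r s : R) : (r + s)%:C = r%:C + s%:C.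
Proof. by rewrite rmorphD. Qed.

Lemma real_complexM (R : realType) (r s : R) : (r * s)%:C = r%:C * s%:C.
Proof. by rewrite rmorphM. Qed.

Section CstarBasics.
Variables (R : realType) (A : cstarType R).
Implicit Types (x y : A) (k t : R[i]).

Lemma scaleAl k x y : (k *: x) * y = k *: (x * y).
Proof. by rewrite -[LHS]cstar_scaleAl. Qed.
Lemma scaleAr k x y : x * (k *: y) = k *: (x * y).
Proof. by rewrite -[LHS]cstar_scaleAr. Qed.
Lemma starK x : star (star x) = x. Proof. exact: cstar_starK. Qed.
Lemma starD x y : star (x + y) = star x + star y.
Proof. exact: cstar_starD. Qed.
Lemma starZ k x : star (k *: x) = Num.conj k *: star x.
Proof. exact: cstar_starZ. Qed.
Lemma starM x y : star (x * y) = star y * star x.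
Proof. exact: cstar_starM. Qed.
Lemma star0 : star (0 : A) = 0.
Proof. by rewrite -[in LHS](scale0r (0 : A)) starZ rmorph0 scale0r. Qed.
Lemma starN x : star (- x) = - star x.
Proof. by apply: (addrI (star x)); rewrite -starD !subrr star0. Qed.
Lemma starB x y : star (x - y) = star x - star y.
Proof. by rewrite starD starN. Qed.
Lemma star1 : star (1 : A) = 1.
Proof. by rewrite -[LHS]mul1r -{1}(starK 1) -starM mul1r starK. Qed.

Lemma normM x y : `|x * y| <= `|x| * `|y|.
Proof. exact: cstar_normM. Qed.

Lemma norm_starM x : `|star x * x| = `|x| ^+ 2.
Proof. exact: cstar_norm_star. Qed.

(** The C*-identity gives [|z| ^+ 2 <= |star z| * |z|]; cancel [|z|], then take [z] to be [x] and
    [star x]. *)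
Lemma norm_star x : `|star x| = `|x|.
Proof.
have le1 (z : A) : `|z| <= `|star z|.
  have [->|z0] := eqVneq z 0; first by rewrite normr0.
  rewrite -(ler_pM2r (x := `|z|)) ?normr_gt0// -expr2 -norm_starM.
  exact: normM.
by apply/eqP; rewrite eq_le le1 andbT -{2}(starK x) le1.
Qed.

(** By the C*-identity [|1|] is its own square. Only an inequality is claimed because of the zero
    algebra. *)
Lemma norm1_le1 : `|1 : A| <= 1.
Proof.
have [->|z0] := eqVneq (1 : A) 0; first by rewrite normr0.
rewrite -(ler_pM2r (x := `|1 : A|)) ?normr_gt0// -expr2 -norm_starM.
by rewrite star1 !mul1r.
Qed.

Lemma norm_scale1 t : 0 <= t -> `|t *: (1 : A)| <= t.
Proof.
by move=> t0; rewrite normrZ ger0_norm// ler_piMr// norm1_le1.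
Qed.

Lemma starM_eq0 x : star x * x = 0 -> x = 0.
Proof.
move=> /(congr1 Num.norm); rewrite norm_starM normr0 => /eqP.
by rewrite expf_eq0/= normr_eq0 => /eqP.
Qed.

Lemma norm_small_eq0 x (c : R[i]) :
  0 <= c -> (forall e, 0 < e -> `|x| <= c * e) -> x = 0.
Proof.
move=> c0 small; apply/eqP; rewrite -normr_eq0; apply: contraT => x0.
have xp : 0 < `|x| by rewrite lt_def x0 normr_ge0.
have c1 : 0 < c + 1 by rewrite ltr_wpDl.
have := small (`|x| / (c + 1)) (divr_gt0 xp c1).
rewrite mulrA ler_pdivlMr// mulrC ler_pM2r// -subr_ge0 opprD addrA subrr.
by rewrite add0r oppr_ge0 ler10.
Qed.

(** No rate of decay is assumed: [tau] is nondecreasing and bounded, hence Cauchy, and telescoping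
    passes its tail estimates on to [u]. *)
Lemma cvg_dominated (u : nat -> A) (tau : nat -> R) :
  (forall n, `|u n.+1 - u n| <= (tau n.+1 - tau n)%:C) ->
  (forall n, tau n <= 1) ->
  exists l : A, forall e : R[i], 0 < e -> exists N, forall n, (N <= n)%N ->
    `|l - u n| < e.
Proof.
move=> step tau1.
have tauS n : tau n <= tau n.+1.
  rewrite -subr_ge0 -lecR; exact: le_trans (step n).
have tail N m : `|u (N + m)%N - u N| <= (tau (N + m)%N - tau N)%:C.
  elim: m => [|m IH]; first by rewrite addn0 !subrr normr0.
  rewrite addnS -(subrKA (u (N + m)%N)) (le_trans (ler_normD _ _))//.
  by rewrite -(subrKA (tau (N + m)%N)) rmorphD lerD.
have /cauchy_cvgP/cauchyP ctau : cvg (tau @ \oo).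
  apply: nondecreasing_is_cvgn; first exact/nondecreasing_seqP.
  by exists 1 => _ [n _ <-].
have : cvg (u @ \oo).
  apply/cauchy_cvgP/cauchyP => e e0.
  have eE : e = (complex.Re e)%:C by rewrite RRe_real// gtr0_real.
  have e20 : 0 < complex.Re e / 2 by rewrite divr_gt0// -ltcR -eE.
  have [z [N _ Nz]] := ctau _ e20.
  exists (u N); change (\forall n \near \oo, ball (u N) e (u n)).
  exists N => // n /= Nn; rewrite -ball_normE /ball_/= distrC.
  rewrite -(subnKC Nn); apply: (le_lt_trans (tail _ _)).
  rewrite eE ltcR subnKC//.
  have := Nz N (leqnn N); have := Nz n Nn; rewrite /= -!ball_normE/= => n2 N2.
  apply: le_lt_trans (ler_norm _) _.
  rewrite -(subrKA z) (le_lt_trans (ler_normD _ _))// (splitr (complex.Re e)).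
  by rewrite ltrD// distrC.
move=> /cvg_ex[l ul]; exists l => e e0.
by have /cvgrPdist_lt/(_ _ e0)[N _ slN] := ul; exists N.
Qed.

End CstarBasics.

(** * Square roots by successive approximation *)

Section SquareRoot.
Variables (R : realType) (A : cstarType R).
Implicit Types (x y : A) (k t : R[i]).

(* [u] is the limit of [u_(n+1) = (y + u_n^2) / 2]; the increments are dominated by
   those of the bounded real sequence with the same recursion at [y = 1], so that
   norm [1] is allowed. *)
Lemma sqrt_one_sub y : star y = y -> `|y| <= 1 ->
  exists u, [/\ star u = u, `|u| <= 1, (1 - u) * (1 - u) = 1 - y
    & forall v, v * y = y * v -> v * u = u * v].
Proof.
move=> sy y1.
have [u [u0 uS]] : exists u : nat -> A, u 0%N = 0 /\
    forall n, u n.+1 = 2^-1 *: (y + u n * u n).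
  by exists (fix u n : A := if n is m.+1 then 2^-1 *: (y + u m * u m) else 0).
have [tau [tau0 tauS]] : exists tau : nat -> R, tau 0%N = 0 /\
    forall n, tau n.+1 = 2^-1 * (1 + tau n * tau n).
  by exists (fix t n : R := if n is m.+1 then 2^-1 * (1 + t m * t m) else 0).
have n2 : `|2^-1 : R[i]| = 2^-1 by rewrite ger0_norm// invr_ge0.
have C2 (r : R) : (2^-1 * r)%:C = 2^-1 * r%:C :> R[i].
  by rewrite rmorphM fmorphV rmorph_nat.
have tau01 n : 0 <= tau n <= 1.
  elim: n => [|n /andP[t0 t1]]; first by rewrite tau0 lexx ler01.
  by rewrite tauS; apply/andP; split; nra.
have ule n : `|u n| <= (tau n)%:C.
  elim: n => [|n IH]; first by rewrite u0 tau0 normr0.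
  rewrite uS tauS normrZ n2 C2 ler_wpM2l ?invr_ge0//.
  rewrite real_complexD real_complexM (le_trans (ler_normD _ _))// lerD//.
  by rewrite (le_trans (normM _ _))// ler_pM.
(* This factorization of a difference of squares does not require [a] and [b] to commute. *)
have sub_sqr (a b : A) : a * a - b * b = a * (a - b) + (a - b) * b.
  by rewrite mulrBr mulrBl addrA subrK.
have step n : `|u n.+1 - u n| <= (tau n.+1 - tau n)%:C.
  elim: n => [|n IH].
    by rewrite u0 tau0 !subr0; exact: ule.
  have -> : u n.+2 - u n.+1 = 2^-1 *: (u n.+1 * u n.+1 - u n * u n).
    by rewrite (uS n.+1) [X in _ - X]uS -scalerBr opprD addrACA subrr add0r.
  rewrite normrZ n2.
  have -> : tau n.+2 - tau n.+1 = 2^-1 *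
      (tau n.+1 * (tau n.+1 - tau n) + (tau n.+1 - tau n) * tau n).
    by have h1 := tauS n; have h2 := tauS n.+1; lra.
  rewrite C2 ler_wpM2l ?invr_ge0// sub_sqr real_complexD !real_complexM.
  rewrite (le_trans (ler_normD _ _))// lerD// (le_trans (normM _ _))//.
    by rewrite ler_pM.
  by rewrite ler_pM.
have [l ul] : exists l : A, forall e : R[i], 0 < e ->
    exists N, forall n, (N <= n)%N -> `|l - u n| < e.
  by apply: (cvg_dominated step) => n; have /andP[] := tau01 n.
have u1 n : `|u n| <= 1.
  by rewrite (le_trans (ule n))// (_ : 1 = 1%:C)// lecR; have /andP[] := tau01 n.
have su n : star (u n) = u n.
  elim: n => [|n IH]; first by rewrite u0 star0.
  by rewrite uS starZ starD starM sy IH geC0_conj// invr_ge0.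
have l1 : `|l| <= 1.
  rewrite real_leNgt ?normr_real//; apply/negP => l1.
  have /ul[N /(_ N (leqnn N))] : 0 < `|l| - 1 by rewrite subr_gt0.
  move=> /lt_geF /negP; apply.
  rewrite lerBlDr (le_trans _ (lerD (lexx _) (u1 N)))//.
  by rewrite -{1}(subrK (u N) l) ler_normD.
have fix_l : l = 2^-1 *: (y + l * l).
  apply/eqP; rewrite -subr_eq0; apply/eqP.
  (* One [e] bounds the distance from [l] to [u N.+1], the other the change of the right-hand side:
     half of a square is 1-Lipschitz on the unit ball. *)
  apply: (@norm_small_eq0 _ _ _ 2) => // e /ul[N uN].
  rewrite -(subrKA (u N.+1)) (le_trans (ler_normD _ _))//.
  rewrite mulr_natl mulr2n lerD// ?(ltW (uN _ (leqnSn N)))//.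
  rewrite uS -scalerBr opprD addrACA subrr add0r normrZ n2.
  rewrite sub_sqr -[leRHS](mulKf (x := 2)) ?pnatr_eq0// ler_wpM2l ?invr_ge0//.
  rewrite (le_trans (ler_normD _ _))// mulr_natl mulr2n.
  have uNe : `|u N - l| <= e by rewrite distrC ltW// uN.
  rewrite lerD// (le_trans (normM _ _))//.
    by rewrite -[leRHS]mul1r ler_pM.
  by rewrite -[leRHS]mulr1 ler_pM.
exists l; split => //.
- apply/eqP; rewrite -subr_eq0; apply/eqP.
  apply: (@norm_small_eq0 _ _ _ 2) => // e /ul[N /(_ N (leqnn N)) /ltW uN].
  rewrite -(subrKA (u N)) (le_trans (ler_normD _ _))// mulr_natl mulr2n.
  rewrite lerD//; last by rewrite distrC.
  by rewrite -{1}(su N) -starB norm_star.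
(* The fixed point equation reads [2 l = y + l^2], which is [(1 - l)^2 = 1 - y] rearranged. *)
- have /(congr1 (fun x => 2 *: x)) := fix_l.
  rewrite scalerA divff ?pnatr_eq0// scale1r scaler_nat mulr2n => ll.
  rewrite mulrBr mulr1 mulrBl mul1r opprB -addrA; congr (1 + _).
  by rewrite addrCA -opprD ll opprD addrCA subrr addr0.
- move=> v vy.
  have vu n : v * u n = u n * v.
    elim: n => [|n IH]; first by rewrite u0 mulr0 mul0r.
    rewrite uS scaleAr scaleAl mulrDr mulrDl vy; congr (_ *: (_ + _)).
    by rewrite mulrA IH -mulrA IH mulrA.
  apply/eqP; rewrite -subr_eq0; apply/eqP.
  apply: (@norm_small_eq0 _ _ _ (`|v| + `|v|)); first by rewrite addr_ge0.
  move=> e /ul[N /(_ N (leqnn N)) /ltW uN].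
  have -> : v * l - l * v = v * (l - u N) - (l - u N) * v.
    by rewrite mulrBr mulrBl vu opprB addrA subrK.
  rewrite (le_trans (ler_normB _ _))// [leRHS]mulrDl lerD// (le_trans (normM _ _))//.
    by rewrite ler_wpM2l.
  by rewrite mulrC ler_wpM2l.
Qed.

End SquareRoot.

(** * Positive elements *)

Section Positivity.
Variables (R : realType) (A : cstarType R).
Implicit Types (x y h k a : A) (c t : R[i]).

Local Notation "c '%:1'" := (c *: (1 : A) : A)
  (at level 2, right associativity, only parsing).

(* For self-adjoint [x], the spectrum is nonnegative iff [|t - x| <= t] for some
   [t >= 0]. *)
Definition pos x : Prop :=
  star x = x /\ exists2 t : R[i], 0 <= t & `|t%:1 - x| <= t.

Lemma star_scale1 t : 0 <= t -> star (t%:1) = t%:1.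
Proof. by move=> t0; rewrite starZ star1 geC0_conj. Qed.

Lemma pos_scale c x : 0 <= c -> pos x -> pos (c *: x).
Proof.
move=> c0 [sx [t t0 tx]]; split; first by rewrite starZ sx geC0_conj.
exists (c * t); first exact: mulr_ge0.
by rewrite -scalerA -scalerBr normrZ ger0_norm// ler_wpM2l.
Qed.

Lemma pos_add x y : pos x -> pos y -> pos (x + y).
Proof.
move=> [sx [t t0 tx]] [sy [s s0 ty]]; split; first by rewrite starD sx sy.
exists (t + s); first exact: addr_ge0.
by rewrite scalerDl opprD addrACA (le_trans (ler_normD _ _))// lerD.
Qed.

Lemma pos_scale1 c : 0 <= c -> pos (c%:1).
Proof.
move=> c0; split; first exact: star_scale1.
by exists c => //; rewrite subrr normr0.
Qed.

Lemma pos0 : pos 0.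
Proof. by have := pos_scale1 (lexx 0); rewrite scale0r. Qed.

Lemma pos_norm_sub x t : star x = x -> `|x| <= t -> pos (t%:1 - x).
Proof.
move=> sx xt; have t0 : 0 <= t by exact: le_trans xt.
split; first by rewrite starB star_scale1// sx.
by exists t => //; rewrite subKr.
Qed.

(** For [t > 0], write [x / t = 1 - y] with [|y| <= 1] and rescale the root [1 - u] of [1 - y] by
    [sqrtC t]. The commutation clause later makes roots of commuting elements commute. *)
Lemma pos_sqrt x : pos x ->
  exists r, [/\ star r = r, pos r, r * r = x
    & forall v, v * x = x * v -> v * r = r * v].
Proof.
move=> [sx [t t0 tx]]; have [t00|tn0] := eqVneq t 0.
  move: tx; rewrite t00 scale0r sub0r normrN normr_le0 => /eqP ->.
  exists 0; split; rewrite ?mulr0 ?star0//; first exact: pos0.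
have tV0 : 0 <= t^-1 by rewrite invr_ge0.
have [||u [su u1 u2 cu]] := @sqrt_one_sub R A (1 - t^-1 *: x).
- by rewrite starB star1 starZ sx geC0_conj.
- rewrite -(ler_pM2l (x := t)) ?lt_def ?tn0// mulr1 -[X in X * _]ger0_norm//.
  by rewrite -normrZ scalerBr scalerA divff// scale1r.
have s0 : 0 <= sqrtC t by rewrite sqrtC_ge0.
have pr : pos (1 - u).
  by have := pos_norm_sub su u1; rewrite scale1r.
exists (sqrtC t *: (1 - u)); split.
- by rewrite starZ geC0_conj// pr.1.
- exact: pos_scale.
- rewrite scaleAr scaleAl scalerA -expr2 sqrtCK u2 subKr scalerA divff//.
  by rewrite scale1r.
- move=> v vx; rewrite scaleAr scaleAl mulrBr mulrBl mulr1 mul1r cu//.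
  by rewrite mulrBr mulrBl mulr1 mul1r scaleAr scaleAl vx.
Qed.

(* [h + i k] is [sqrtC c] times a unitary. *)
Lemma norm_sa_circle h k c : star h = h -> star k = k -> h * k = k * h ->
  0 <= c -> h * h + k * k = c%:1 -> `|h| <= sqrtC c.
Proof.
move=> sh sk hk c0 hkc; pose i : R[i] := 'i%R; pose u := h + i *: k.
have i2 : i * i = -1 by rewrite -expr2 sqrCi.
have su : star u = h - i *: k by rewrite starD starZ sh sk conjCi scaleNr.
have uu : star u * u = c%:1.
  rewrite su mulrBl !mulrDr !scaleAl !scaleAr scalerA i2 scaleN1r.
  by rewrite -hkc hk opprD opprK addrA addrK.
have nu : `|u| <= sqrtC c.
  rewrite -(@ler_pXn2r _ 2)// ?nnegrE ?sqrtC_ge0// sqrtCK -norm_starM uu.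
  exact: norm_scale1.
have -> : h = 2^-1 *: (u + star u).
  rewrite su addrACA subrr addr0 -mulr2n -[h *+ 2]scaler_nat scalerA mulVf ?scale1r//.
rewrite normrZ ger0_norm ?invr_ge0// -[leRHS](mulKf (x := 2)) ?pnatr_eq0//.
rewrite ler_wpM2l ?invr_ge0// mulr_natl mulr2n (le_trans (ler_normD _ _))//.
by rewrite norm_star lerD.
Qed.

(** The additive part of [(1 - 2b)^2 + (4b - 4b^2) = 1]. *)
Lemma cancel_cross x y z : z - x - (x - y) + (x + x - y) = z.
Proof.
by rewrite -!addrA opprB -addrA addKr (addrCA y) subrr addr0 addNr addr0.
Qed.

(** The additive part of [2 a s = (a + s)^2 - (a - s)^2 - 2 s a]. *)
Lemma cancel_squares x y z h :
  y + y = x + y + (z + h) - (x - y + (- z + h)) - (z + z).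
Proof.
rewrite (opprD (x - y)) opprB (opprD (- z)) opprK (addrACA (x + y)) (addrC x).
by rewrite (addrACA y) subrr addr0 (addrACA z) subrr addr0 addrK.
Qed.

(** Normalize [h] to [g] of norm 1 and put [b = g^2], [k^2 = 1 - b]. As for the sine and cosine of a
    double angle, [(1 - 2b)^2 + (2gk)^2 = 1], so [|1 - 2b| <= 1]: the threshold of [2b] is 1. *)
Lemma pos_sqr h : star h = h -> pos (h * h).
Proof.
move=> sh; have [->|h0] := eqVneq h 0.
  by rewrite mul0r; exact: pos0.
set c := `|h|; have c0 : 0 < c by rewrite normr_gt0.
pose g := c^-1 *: h.
have sg : star g = g by rewrite starZ sh geC0_conj// invr_ge0 ltW.
have ng : `|g| = 1.
  by rewrite normrZ ger0_norm ?invr_ge0 ?(ltW c0)// mulVf ?gt_eqF.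
have hE : h = c *: g by rewrite scalerA divff ?scale1r// gt_eqF.
clearbody g; pose b := g * g.
have sb : star b = b by rewrite starM sg.
have nb : `|b| <= 1 by rewrite /b -{1}sg norm_starM ng expr1n.
have [u [su u1 u2 cu]] := sqrt_one_sub sb nb.
pose k := 1 - u; have sk : star k = k by rewrite starB star1 su.
have gk : g * k = k * g.
  by rewrite mulrBr mulrBl mulr1 mul1r cu// mulrA.
have bk : b * k = k * b by rewrite -mulrA gk mulrA gk mulrA.
have bgk : b * (g * k) = g * k * b by rewrite -!mulrA -bk /b !mulrA.
have gkgk : g * k * (g * k) = b - b * b.
  by rewrite {1}gk mulrA -(mulrA k) -/b -bk -mulrA u2 mulrBr mulr1.
have hhE : h * h = (c ^+ 2 / 2) *: (2 *: b).
  by rewrite scalerA divfK ?pnatr_eq0// hE scaleAl scaleAr scalerA.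
clearbody b k.
have h'1 : `|1 - 2 *: b| <= 1.
  rewrite -[leRHS](sqrtC1 R[i]).
  apply: (@norm_sa_circle _ (2 *: (g * k))) => //.
  - by rewrite starB star1 starZ sb geC0_conj.
  - by rewrite starZ starM sg sk gk geC0_conj.
  - by rewrite mulrBl mulrBr mul1r mulr1 !(scaleAl, scaleAr) bgk.
  - have -> : 2 *: (g * k) * (2 *: (g * k)) =
        2 *: b + 2 *: b - 4 *: (b * b).
      by rewrite scaleAl scaleAr scalerA -natrM gkgk scalerBr -scalerDl -natrD.
    rewrite mulrBl mul1r mulrBr mulr1 scaleAl scaleAr scalerA -natrM scale1r.
    exact: cancel_cross.
rewrite hhE; apply: pos_scale; first by rewrite divr_ge0// exprn_ge0// ltW.
split; first by rewrite starZ sb geC0_conj.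
by exists 1 => //; rewrite scale1r.
Qed.

(** The root [r] of [x] commutes with [y], hence with the root [s] of [y]; so [x y] is the square of
    the self-adjoint [r s]. *)
Lemma pos_mul x y : pos x -> pos y -> x * y = y * x -> pos (x * y).
Proof.
move=> /pos_sqrt[r [sr pr <- cr]] /pos_sqrt[s [ss ps <- cs]] xy.
have rs : r * s = s * r.
  by apply: cs; apply/esym/cr.
have -> : r * r * (s * s) = (r * s) * (r * s).
  by rewrite -!mulrA (mulrA s r) -rs -mulrA.
by apply: pos_sqr; rewrite starM sr ss rs.
Qed.

(** The product [(t - x)(t + x) = t^2 - x^2] is positive. With [h] its root, [x^2 + h^2 = t^2]. *)
Lemma pos_norm_le x t : star x = x -> 0 <= t -> pos (t%:1 - x) ->
  pos (t%:1 + x) -> `|x| <= t.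
Proof.
move=> sx t0 p1 p2.
have E : (t%:1 - x) * (t%:1 + x) = (t ^+ 2)%:1 - x * x.
  rewrite mulrBl !mulrDr !scaleAl !scaleAr !mul1r !mulr1 scalerA -expr2.
  by rewrite opprD addrA addrK.
have E' : (t%:1 + x) * (t%:1 - x) = (t ^+ 2)%:1 - x * x.
  rewrite mulrDl !mulrBr !scaleAl !scaleAr !mul1r !mulr1 scalerA -expr2.
  by rewrite addrA subrK.
have /pos_sqrt[h [sh _ hh ch]] : pos ((t ^+ 2)%:1 - x * x).
  by rewrite -E; apply: pos_mul => //; rewrite E E'.
rewrite -(sqrCK t0); apply: (@norm_sa_circle x h) => //.
- by apply: ch; rewrite mulrBr mulrBl scaleAl scaleAr mul1r mulr1 mulrA.
- exact: exprn_ge0.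
- by rewrite hh addrC subrK.
Qed.

(** The threshold in [pos] can thus always be taken to be the norm. *)
Lemma pos_norm_sub_le x : pos x -> `| `|x|%:1 - x| <= `|x|.
Proof.
move=> px; have px' := pos_norm_sub px.1 (lexx `|x|).
apply: pos_norm_le => //; first exact: px'.1.
- by rewrite subKr.
- by apply: pos_add => //; exact: pos_scale1.
Qed.

(** With [t = |x + y|], the element [t - x = (t - (x + y)) + y] is positive. *)
Lemma pos_norm_mono x y : pos x -> pos y -> `|x| <= `|x + y|.
Proof.
move=> px py; apply: pos_norm_le => //; first exact: px.1.
  have [sxy _] := pos_add px py.
  have := pos_add (pos_norm_sub sxy (lexx _)) py.
  by rewrite opprD addrA subrK.
by apply: pos_add => //; exact: pos_scale1.
Qed.

(* [w = a a^*] is positive because [a a^* + a^* a] is a sum of squares. With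
   [T = |w|], the element [w (T + w) = a (T + a^* a) a^*] has norm at most [T^2],
   although it dominates [2 w^2]. *)
Lemma neg_starM_eq0 a : pos (- (star a * a)) -> a = 0.
Proof.
move=> na; set s := star a.
have w0 : pos (2 *: (a * s)).
  have i2 : ('i : R[i])%R * 'i%R = -1 by rewrite -expr2 sqrCi.
  (* Up to real factors, [p] and [q] are the real and imaginary parts of [a];
     [p^2 + q^2 = 2 (a s + s a)]. *)
  pose p := a + s; pose q := ('i%R : R[i]) *: (a - s).
  have sp : star p = p by rewrite starD starK addrC.
  have sq : star q = q.
    by rewrite starZ conjCi starB starK scaleNr -scalerN opprB.
  have -> : 2 *: (a * s) = p * p + q * q + 2 *: (- (s * a)).
    rewrite scaleAl scaleAr scalerA i2 scaleN1r.
    rewrite scaler_nat mulr2n scalerN scaler_nat mulr2n.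
    rewrite !(mulrDl, mulrDr) !mulrN !mulNr opprK; exact: cancel_squares.
  apply: pos_add; last exact: pos_scale.
  by apply: pos_add; exact: pos_sqr.
pose w := a * s.
have pw : pos w.
  have -> : w = 2^-1 *: (2 *: w) by rewrite scalerA mulVf ?pnatr_eq0// scale1r.
  by apply: pos_scale => //; rewrite invr_ge0.
pose T := `|a| ^+ 2; have T0 : 0 <= T by rewrite exprn_ge0.
have nw : `|w| = T by rewrite /w -{1}(starK a) norm_starM norm_star.
have nsa : `|s * a| = T by exact: norm_starM.
have cw : `|T%:1 + s * a| <= T.
  by have := pos_norm_sub_le na; rewrite normrN nsa opprK.
have yE : T *: w + w * w = a * (T%:1 + s * a) * s.
  by rewrite mulrDr mulrDl scaleAr mulr1 scaleAl !mulrA.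
have ny : `|T *: w + w * w| <= T ^+ 2.
  rewrite yE (le_trans (normM _ _))// norm_star.
  have -> : T ^+ 2 = `|a| * T * `|a| by rewrite mulrAC -expr2.
  by rewrite ler_wpM2r// (le_trans (normM _ _))// ler_wpM2l.
have sw := pw.1.
have sy : star (T *: w + w * w) = T *: w + w * w.
  by rewrite starD starZ starM sw geC0_conj.
have pwT : pos (w * (T%:1 - w)).
  apply: pos_mul => //; first by apply: pos_norm_sub; rewrite ?nw.
  by rewrite mulrBl mulrBr scaleAl scaleAr mul1r mulr1.
(* Here [T^2 - 2 w^2] is the sum of [T^2 - (T w + w^2)] and [w (T - w)], both positive. *)
have le2 : `|2 *: (w * w)| <= T ^+ 2.
  apply: pos_norm_le; first by rewrite starZ starM sw geC0_conj.
  - exact: exprn_ge0.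
  - have := pos_add (pos_norm_sub sy ny) pwT.
    rewrite mulrBr scaleAr mulr1 opprD -addrA addrACA addNr add0r -opprD.
    by rewrite -mulr2n -[w * w *+ 2]scaler_nat.
  - apply: pos_add; first exact/pos_scale1/exprn_ge0.
    by apply: pos_scale => //; exact: pos_sqr.
have : T ^+ 2 + T ^+ 2 <= T ^+ 2.
  move: le2; rewrite normrZ ger0_norm// -{1}sw norm_starM nw.
  by rewrite mulr_natl mulr2n.
rewrite gerDl => T2.
have : T ^+ 2 == 0 by rewrite eq_le T2 exprn_ge0.
by rewrite !expf_eq0/= normr_eq0 => /eqP.
Qed.

(* With [b = a^* a] and [n = |b| - b], one has [(a n)^* (a n) = - |b| n^2]. *)
Theorem pos_starM a : pos (star a * a).
Proof.
set b := star a * a; have sb : star b = b by rewrite starM starK.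
have [m [sm pm mm cm]] := pos_sqrt (pos_sqr sb).
have bm : b * m = m * b by apply: cm; rewrite mulrA.
pose n := m - b; have sn : star n = n by rewrite starB sm sb.
have bn : b * n = n * b by rewrite mulrBr mulrBl bm.
have mn : m * n = n * m by rewrite mulrBr mulrBl bm.
have nmb : n * m = - (n * b).
  apply/eqP; rewrite -addr_eq0 -mulrDr /n mulrBl !mulrDr mm bm.
  by rewrite (addrC (b * b)) subrr.
have an0 : a * n = 0.
  apply: neg_starM_eq0.
  rewrite starM sn mulrA -(mulrA n) -/b -mulNr -nmb -mn -mulrA.
  by apply: pos_mul => //; [exact: pos_sqr|rewrite mulrA mn -!mulrA mn].
(* From [a n = 0] follow [b n = 0] and [n^2 = n m - n b = 0], so [b] equals the positive root
   [m]. *)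
have nb0 : n * b = 0 by rewrite -bn /b -mulrA an0 mulr0.
have nn : star n * n = 0 by rewrite sn mulrBr nmb nb0 oppr0 addr0.
have := starM_eq0 nn.
by move/eqP; rewrite subr_eq0 => /eqP <-.
Qed.

End Positivity.

(** * States *)

Section HahnBanach.
Variables (R : realType) (V : lmodType R[i]) (p : V -> R).
Hypothesis pD : forall x y, p (x + y) <= p x + p y.
Hypothesis pZ : forall (k : R) x, 0 <= k -> p (k%:C *: x) = k * p x.

(* Partial functionals are graphs. A dominated linear graph is automatically that of
   a function: [(0, a)] in it forces [a <= p 0 = 0]. *)
Let lin_graph (G : set (V * R)) := forall (k : R) x a y b,
  G (x, a) -> G (y, b) -> G (k%:C *: x + y, k * a + b).
Let dominated (G : set (V * R)) := forall x a, G (x, a) -> a <= p x.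

Let p0 : p 0 = 0.
Proof. by have := pZ 0 (lexx 0); rewrite scaler0 mul0r. Qed.

(** The value [c] at [x0] has to lie between all [a - p (x - x0)] and all [p (y + x0) - b], for
    [(x, a)] and [(y, b)] in the graph; subadditivity leaves room for the supremum of the former.
    Domination at [x + k x0] follows on dividing by the absolute value of [k]. *)
Let extend_graph (A : set (V * R)) x0 : lin_graph A -> dominated A ->
  A !=set0 ->
  exists2 B, lin_graph B /\ dominated B & A `<=` B /\ exists c, B (x0, c).
Proof.
move=> Al Ad [[xA aA] AA].
have A0 : A (0, 0).
  have := Al (-1) _ _ _ _ AA AA.
  by rewrite rmorphN rmorph1 scaleN1r addNr mulN1r addNr.
have AZ k x a : A (x, a) -> A (k%:C *: x, k * a).
  by move=> Ax; have := Al k _ _ _ _ Ax A0; rewrite !addr0.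
have AD x a y b : A (x, a) -> A (y, b) -> A (x + y, a + b).
  by move=> Ax Ay; have := Al 1 _ _ _ _ Ax Ay; rewrite rmorph1 scale1r mul1r.
pose S := [set u | exists x a, A (x, a) /\ u = a - p (x - x0)].
have Sub y b : A (y, b) -> ubound S (p (y + x0) - b).
  move=> Ay u [x [a [Ax ->]]]; rewrite lerBlDr addrAC lerBrDr.
  apply: le_trans (Ad _ _ (AD _ _ _ _ Ax Ay)) _.
  have <- : x - x0 + (y + x0) = x + y by rewrite addrACA addNr addr0.
  by rewrite [leRHS]addrC; exact: pD.
have S0 : S !=set0 by exists (aA - p (xA - x0)); exists xA, aA.
have hS : has_ubound S by exists (p (xA + x0) - aA); exact: Sub AA.
pose c := sup S.
have c1 x a : A (x, a) -> a - c <= p (x - x0).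
  move=> Ax; rewrite lerBlDr -lerBlDl; apply: ub_le_sup => //.
  by exists x, a.
have c2 x a : A (x, a) -> a + c <= p (x + x0).
  by move=> Ax; rewrite -lerBrDl; apply: ge_sup => //; exact: Sub.
exists [set u | exists x a (k : R), A (x, a) /\ u = (x + k%:C *: x0, a + k * c)].
  split.
    move=> k _ _ _ _ [x [a [l [Ax [-> ->]]]]] [y [b [m [Ay [-> ->]]]]].
    exists (k%:C *: x + y), (k * a + b), (k * l + m); split; first exact: Al.
    congr (_, _); last by rewrite mulrDr mulrDl mulrA addrACA.
    by rewrite scalerDr rmorphD rmorphM scalerDl scalerA addrACA.
  move=> _ _ [x [a [k [Ax [-> ->]]]]].
  have [k0|k0|->] := ltgtP k 0.
  - have nk : 0 < - k by rewrite oppr_gt0.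
    have := c1 _ _ (AZ (- k)^-1 _ _ Ax).
    rewrite -(ler_pM2l nk) -pZ ?(ltW nk)// mulrBr mulrA divff ?gt_eqF// mul1r.
    rewrite scalerBr scalerA -rmorphM divff ?gt_eqF// rmorph1 scale1r.
    by rewrite mulNr opprK rmorphN scaleNr opprK.
  - have := c2 _ _ (AZ k^-1 _ _ Ax).
    rewrite -(ler_pM2l k0) -pZ ?(ltW k0)// mulrDr mulrA divff ?gt_eqF// mul1r.
    by rewrite scalerDr scalerA -rmorphM divff ?gt_eqF// rmorph1 scale1r.
  - by rewrite rmorph0 scale0r mul0r !addr0; exact: Ad.
split.
  by move=> [x a] Ax; exists x, a, 0; rewrite rmorph0 scale0r mul0r !addr0.
by exists c, 0, 0, 1; rewrite rmorph1 scale1r mul1r !add0r.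
Qed.

Theorem hahn_banach v : exists f : V -> R,
  [/\ forall x y, f (x + y) = f x + f y, forall (k : R) x, f (k%:C *: x) = k * f x,
      forall x, f x <= p x & f v = p v].
Proof.
pose good G := [/\ lin_graph G, dominated G & G (v, p v)].
have [F FP totF|A [AP Amax]] :=
    @Zorn_bigcup (V * R)%type [set G | G = set0 \/ good G].
  have [F0|] := pselect (forall X, F X -> X = set0).
    by left; apply/seteqP; split => // x [X /F0 ->].
  move=> /existsNP[X /not_implyP[FX X0]]; right.
  have goodF Y u : F Y -> Y u -> good Y.
    by move=> /FP[->|].
  have [/X0//|[_ _ Xv]] := FP _ FX.
  split; last by exists X.
    move=> k x a y b [Y FY Yx] [Z FZ Zy].
    have [YZ|ZY] := totF _ _ FY FZ.
      by exists Z => //; have [Zl _ _] := goodF _ _ FZ Zy; apply: Zl => //; exact: YZ.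
    by exists Y => //; have [Yl _ _] := goodF _ _ FY Yx; apply: Yl => //; exact: ZY.
  by move=> x a [Y FY Yx]; have [_ Yd _] := goodF _ _ FY Yx; exact: Yd.
have {AP} [Al Ad Av] : good A.
  case: AP => // A0.
  pose B := [set u | exists k : R, u = (k%:C *: v, k * p v)].
  have Bv : B (v, p v) by exists 1; rewrite rmorph1 scale1r mul1r.
  exfalso; apply: (Amax B).
    by rewrite A0; split => // B0; exact: B0 Bv.
  right; split => //.
    move=> k _ _ _ _ [l [-> ->]] [m [-> ->]]; exists (k * l + m).
    by rewrite rmorphD rmorphM scalerDl scalerA mulrDl mulrA.
  move=> _ _ [k [-> ->]]; have [k0|k0] := leP 0 k; first by rewrite pZ.
  (* For [k < 0], use [0 = p 0 <= p (k v) + (- k) p v]. *)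
  have := pD (k%:C *: v) ((- k)%:C *: v).
  rewrite -scalerDl -rmorphD subrr rmorph0 scale0r p0 (@pZ (- k)) ?oppr_ge0 ?(ltW k0)//.
  by rewrite mulNr subr_ge0.
have tot x : exists a, A (x, a).
  apply: contrapT => nx.
  have [|B [Bl Bd] [AB [c Bc]]] := @extend_graph A x Al Ad; first by exists (v, p v).
  apply: (Amax B); last by right; split => //; exact: AB.
  by split => // BA; apply: nx; exists c; exact: BA.
have le_ab x a b : A (x, a) -> A (x, b) -> b <= a.
  move=> Aa Ab; have := Ad _ _ (Al (-1) _ _ _ _ Aa Ab).
  by rewrite rmorphN rmorph1 scaleN1r addNr p0 mulN1r addrC subr_le0.
have uniq_ab x a b : A (x, a) -> A (x, b) -> a = b.
  by move=> Aa Ab; apply/eqP; rewrite eq_le (le_ab _ _ _ Aa Ab) (le_ab _ _ _ Ab Aa).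
have [f Af] := choice tot.
have A0 : A (0, 0).
  have := Al (-1) _ _ _ _ Av Av.
  by rewrite rmorphN rmorph1 scaleN1r addNr mulN1r addNr.
exists f; split.
- move=> x y; apply: uniq_ab (Af _) _.
  by have := Al 1 _ _ _ _ (Af x) (Af y); rewrite rmorph1 scale1r mul1r.
- move=> k x; apply: uniq_ab (Af _) _.
  by have := Al k _ _ _ _ (Af x) A0; rewrite !addr0.
- by move=> x; exact: Ad.
- exact: uniq_ab (Af _) Av.
Qed.

End HahnBanach.

Section ExistsState.
Variables (R : realType).

(** The complex functional whose real part is [h]. *)
Lemma scalar_complexify (V : lmodType R[i]) (h : V -> R) :
  (forall x y, h (x + y) = h x + h y) ->
  (forall (k : R) x, h (k%:C *: x) = k * h x) ->
  scalar (fun x => h x +i* (- h ('i *: x))).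
Proof.
move=> hD hZ k x y; case: k => a b.
have kE z : (a +i* b) *: z = a%:C *: z + b%:C *: ('i *: z).
  by rewrite scalerA -scalerDl; congr (_ *: _); simpc.
have ikE z : 'i *: ((a +i* b) *: z) = a%:C *: ('i *: z) + (- b)%:C *: z.
  by rewrite !scalerA -scalerDl; congr (_ *: _); simpc.
rewrite scalerDr ikE kE !hD !hZ; apply/eqP; rewrite eq_complex /=.
by apply/andP; split; apply/eqP; ring.
Qed.

(* The functional norming [t + z], where [z = w^* w] and [t = |z|], satisfies
   [f(1) = 1] and [f(z) = t] because [|t + z| = 2 t]. *)
Lemma exists_state (A : cstarType R) (w : A) : w <> 0 ->
  exists sigma : A -> R[i], is_state sigma /\ 0 < sigma (star w * w).
Proof.
move=> w0; pose z := star w * w; have pz : pos z := pos_starM w.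
pose t := `|z|.
have t0 : 0 < t.
  by rewrite normr_gt0; apply: contra_notN w0 => /eqP/starM_eq0.
have tE : t = (complex.Re t)%:C by rewrite RRe_real// gtr0_real.
pose p (x : A) := complex.Re `|x|.
have pE x : (p x)%:C = `|x| by rewrite RRe_real ?normr_real.
have pD x y : p (x + y) <= p x + p y.
  by rewrite -lecR real_complexD !pE; exact: ler_normD.
have pZ (k : R) x : 0 <= k -> p (k%:C *: x) = k * p x.
  move=> k0; apply: complexI; rewrite real_complexM !pE normrZ ger0_norm//.
  by rewrite ler0c.
have [f [fD fZ fp fv]] := hahn_banach pD pZ (t *: (1 : A) + z).
(* With [L = |t + z|], [(L - t) - z = L - (t + z)] is positive, which gives [|z| <= L - t]. *)
have t2 : t + t <= `|t *: (1 : A) + z|.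
  have pt1 := pos_scale1 A (ltW t0).
  have pv : pos (t *: (1 : A) + z) by exact: pos_add.
  rewrite -lerBrDr; apply: pos_norm_le; first exact: pz.1.
  - by rewrite subr_ge0 addrC; exact: pos_norm_mono.
  - have := pos_norm_sub pv.1 (lexx _).
    by rewrite opprD addrA -scalerBl.
  - have tL : t <= `|t *: (1 : A) + z| by rewrite addrC; exact: pos_norm_mono.
    by apply: pos_add => //; apply: pos_scale1; rewrite subr_ge0.
have ft : f (t *: (1 : A)) <= complex.Re t.
  by apply: le_trans (fp _) _; rewrite -lecR pE -tE norm_scale1// ltW.
have fz : f z <= complex.Re t by exact: fp.
(* Neither summand exceeds [t], so both equal [t]. *)
have f2 : complex.Re t + complex.Re t <= f (t *: (1 : A)) + f z.
  by rewrite -fD fv -lecR real_complexD -tE pE.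
have Rt0 : 0 < complex.Re t by rewrite -ltcR -tE.
have f1 : f 1 = 1.
  have ftE : f (t *: (1 : A)) = complex.Re t * f 1 by rewrite {1}tE fZ.
  by apply: (mulfI (lt0r_neq0 Rt0)); rewrite -ftE mulr1; lra.
have fzt : 0 < f z by lra.
have f0 : f 0 = 0 by apply: (addrI (f 0)); rewrite -fD !addr0.
have fN x : f (- x) = - f x.
  by apply: (addrI (f x)); rewrite -fD !subrr f0.
(* If [|s - x| <= s], then [s - f x = f (s - x) <= s]. *)
have fpos x : pos x -> 0 <= f x.
  move=> [sx [s s0 sxs]].
  have sE : s = (complex.Re s)%:C by rewrite RRe_real// ger0_real.
  have : f (s *: (1 : A)) + f (- x) <= complex.Re s.
    by rewrite -fD; apply: le_trans (fp _) _; rewrite -lecR pE -sE.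
  by rewrite sE fZ f1 mulr1 fN /=; lra.
(* So far [f] is only real linear. Averaging over [x] and [star x] makes [h] vanish on ['i *: x] for
   self-adjoint [x], so its complexification is real there. *)
pose h x := f (2^-1 *: (x + star x)).
have hD x y : h (x + y) = h x + h y.
  by rewrite /h -fD -scalerDr starD addrACA.
have hZ (k : R) x : h (k%:C *: x) = k * h x.
  have kJ : Num.conj k%:C = k%:C :> R[i] by exact: conjc_real.
  by rewrite /h starZ kJ -scalerDr scalerA mulrC -scalerA fZ.
have hsa x : star x = x -> h x = f x /\ h ('i *: x) = 0.
  move=> sx; rewrite /h sx -mulr2n -[x *+ 2]scaler_nat scalerA mulVf ?scale1r//.
  split => //; rewrite starZ sx -scalerDl.
  have -> : 'i + Num.conj 'i = 0 :> R[i].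
    by apply/eqP; rewrite eq_complex /= subrr addr0 eqxx.
  by rewrite scale0r scaler0.
have sig x : pos x -> h x +i* (- h ('i *: x)) = (f x)%:C.
  by move=> [sx _]; have [-> ->] := hsa x sx; rewrite oppr0.
exists (fun x => h x +i* (- h ('i *: x))); split; first split.
- exact: scalar_complexify.
- by move=> a; rewrite sig ?ler0c; [exact/fpos/pos_starM|exact: pos_starM].
- by have [-> ->] := hsa 1 (star1 A); rewrite oppr0 f1.
- by rewrite sig// ltcR.
Qed.

End ExistsState.

(** * Characters *)

Section Scalar.
Variables (R : realType) (V : lmodType R[i]) (f : V -> R[i]).
Hypothesis fl : scalar f.

Lemma scalar_add x y : f (x + y) = f x + f y.
Proof. by have := fl 1 x y; rewrite scale1r mul1r. Qed.

Lemma scalar_zero : f 0 = 0.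
Proof. by apply: (addrI (f 0)); rewrite -scalar_add !addr0. Qed.

Lemma scalar_scale k x : f (k *: x) = k * f x.
Proof. by have := fl k x 0; rewrite !addr0 scalar_zero addr0. Qed.

Lemma scalar_opp x : f (- x) = - f x.
Proof. by rewrite -scaleN1r scalar_scale mulN1r. Qed.

Lemma scalar_sub x y : f (x - y) = f x - f y.
Proof. by rewrite scalar_add scalar_opp. Qed.

End Scalar.

Section Characters.
Variables (R : realType) (A : cstarType R).
Implicit Types (a b : A) (x : spec A).

Lemma spec1 x : x 1 = 1. Proof. exact: (spec_monoid x).1. Qed.

Lemma specM x a b : x (a * b) = x a * x b.
Proof. exact: (spec_monoid x).2. Qed.

(* Compare [|x(a + i s)|^2] with [|a + i s|^2 = |a^2 + s^2|] for all real [s]. *)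
Lemma spec_real x a : star a = a -> complex.Im (x a) = 0.
Proof.
move=> sa; set r := complex.Re (x a); set b := complex.Im (x a).
pose n := complex.Re `|a|; have nE : `|a| = n%:C by rewrite RRe_real ?normr_real.
have bound (s : R) : r ^+ 2 + (b + s) ^+ 2 <= n ^+ 2 + s ^+ 2.
  pose im : R[i] := 0 +i* s.
  have isJ : Num.conj im = - im by apply/eqP; rewrite eq_complex /= oppr0 !eqxx.
  have is2 : im * im = - (s ^+ 2)%:C by apply/eqP; rewrite eq_complex /=; simpc.
  have nn : `|a + im *: (1 : A)| ^+ 2 <= (n ^+ 2 + s ^+ 2)%:C.
    rewrite -norm_starM starD starZ star1 sa isJ mulrDl !mulrDr !scaleAl !scaleAr.
    rewrite mul1r mulr1 scalerA mul1r mulNr is2 opprK scaleNr addrA addrK.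
    rewrite (le_trans (ler_normD _ _))// real_complexD lerD//.
      by rewrite (le_trans (normM _ _))// nE -real_complexM.
    by apply: norm_scale1; rewrite ler0c sqr_ge0.
  rewrite -lecR; apply: le_trans nn.
  apply: le_trans (_ : `|x (a + im *: (1 : A))| ^+ 2 <= _).
    rewrite (scalar_add (spec_scalar x)) (scalar_scale (spec_scalar x)) spec1 mulr1.
    by rewrite -add_Re2_Im2 lecR raddfD/= raddfD/= addr0.
  by rewrite ler_pXn2r ?nnegrE// spec_norm_le.
apply: contrapT => /eqP b0.
(* This [s] gives [2 b s = 2 n^2 + 2], too large for the bound, from which [s^2] cancels. *)
have := bound ((n ^+ 2 + 1) / b).
have b2 : 0 < b ^+ 2 by rewrite exprn_even_gt0.
have bE : b * ((n ^+ 2 + 1) / b) = n ^+ 2 + 1 by rewrite mulrC divfK.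
set s := (_ / b) in bE *; have := sqr_ge0 r; have := sqr_ge0 n; nra.
Qed.

(** A point of [spec] is linear and multiplicative by definition; compatibility with the star comes
    from its reality on [a + star a] and ['i *: (a - star a)]. *)
Lemma spec_star x a : x (star a) = Num.conj (x a).
Proof.
have xD := scalar_add (spec_scalar x); have xZ := scalar_scale (spec_scalar x).
have := @spec_real x (a + star a).
rewrite starD starK addrC => /(_ erefl).
have := @spec_real x ('i *: (a - star a)).
have Ji : Num.conj 'i = - 'i :> R[i].
  by apply/eqP; rewrite eq_complex /= oppr0 !eqxx.
rewrite starZ starB starK Ji scaleNr -scalerN opprB => /(_ erefl).
rewrite xZ !xD (scalar_opp (spec_scalar x)).
case: (x a) (x (star a)) => [p q] [u v] /=; rewrite !mul0r !mul1r add0r => h1 h2.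
by apply/eqP; rewrite eq_complex /=; apply/andP; split; apply/eqP; lra.
Qed.

Lemma spec_starM x a : x (star a * a) = `|x a| ^+ 2.
Proof. by rewrite specM spec_star mulrC -normCK. Qed.

Lemma spec_state x : is_state x.
Proof.
split; [exact: spec_scalar|move=> a|exact: spec1].
by rewrite spec_starM exprn_ge0.
Qed.

Lemma state_null (f : A -> R[i]) a : is_state f -> f (star a * a) = 0 -> f a = 0.
Proof.
move=> [fl f0 f1] faa.
have fD := scalar_add fl; have fZ := scalar_scale fl.
have E (l : R[i]) : 0 <= l * f (star a) + Num.conj l * f a + `|l| ^+ 2.
  have := f0 (a + (l *: (1 : A) : A)).
  rewrite starD starZ star1 mulrDl !mulrDr !(scaleAl, scaleAr) !mul1r !mulr1.
  by rewrite scalerA !fD !fZ f1 faa add0r mulr1 normCK !addrA.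
have small (c : R[i]) : (forall e : R, 0 < e -> 0 <= e%:C * c + e%:C ^+ 2) ->
    (forall e : R, 0 < e -> 0 <= - (e%:C * c) + e%:C ^+ 2) -> c = 0.
  move=> c1 c2.
  have c1' (e : R) : 0 < e -> 0 <= c + e%:C.
    move=> e0; have eC : 0 < e%:C :> R[i] by rewrite ltcR.
    by have := c1 e e0; rewrite expr2 -mulrDr pmulr_rge0.
  have c2' (e : R) : 0 < e -> 0 <= e%:C - c.
    move=> e0; have eC : 0 < e%:C :> R[i] by rewrite ltcR.
    by have := c2 e e0; rewrite expr2 -mulrN -mulrDr pmulr_rge0// addrC.
  case: c c1' c2' {c1 c2} => u v c1 c2; apply/eqP; rewrite eq_complex /=.
  have := c1 1 ltr01; rewrite lecE /= addr0 => /andP[-> _]; rewrite andbT.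
  have u1 (e : R) : 0 < e -> `|u| <= e.
    move=> e0; have := c1 e e0; have := c2 e e0; rewrite !lecE /=.
    by move=> /andP[_ h1] /andP[_ h2]; rewrite ler_norml; apply/andP; split; lra.
  by rewrite -normr_le0; apply/ler_addgt0Pr => e /u1; rewrite add0r.
have eJ (e : R) : Num.conj e%:C = e%:C :> R[i] by exact: conjc_real.
have eNJ (e : R) : Num.conj (- e%:C) = - e%:C :> R[i].
  by rewrite rmorphN; congr (- _); exact: eJ.
have iJ (e : R) : Num.conj ('i%R * e%:C) = - ('i%R * e%:C) :> R[i].
  by rewrite rmorphM -mulNr; congr (_ * _); [exact: conjCi|exact: eJ].
have iNJ (e : R) : Num.conj (- ('i%R * e%:C)) = 'i%R * e%:C :> R[i].
  by rewrite rmorphN -[RHS]opprK; congr (- _); exact: iJ.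
have s1 : f (star a) + f a = 0.
  apply: small => e e0.
    by have := E e%:C; rewrite eJ ger0_norm ?ler0c ?(ltW e0)// mulrDr.
  have := E (- e%:C); rewrite eNJ normrN ger0_norm ?ler0c ?(ltW e0)//.
  by rewrite -mulrDr mulNr.
have s2 : 'i%R * (f (star a) - f a) = 0.
  apply: small => e e0.
    have := E ('i%R * e%:C).
    rewrite iJ normrM normCi mul1r ger0_norm ?ler0c ?(ltW e0)//.
    by rewrite mulNr -mulrBr mulrAC mulrC.
  have := E (- ('i%R * e%:C)).
  rewrite iNJ normrN normrM normCi mul1r ger0_norm ?ler0c ?(ltW e0)//.
  suff -> : - (e%:C * ('i%R * (f (star a) - f a))) =
      - ('i%R * e%:C) * f (star a) + 'i%R * e%:C * f a by [].
  ring.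
have {}s2 : f (star a) = f a.
  by apply/eqP; rewrite -subr_eq0; move/eqP: s2; rewrite mulf_eq0 (negPf (neq0Ci _)).
move: s1; rewrite s2 -mulr2n => /eqP; rewrite mulrn_eq0/= => /eqP //.
Qed.

(** For [b = a - x(a)], [x] vanishes at [star b * b], hence so does the nonnegative summand [g];
    then [g b = 0], that is, [g a = x a]. *)
Lemma spec_extreme x (g h : A -> R[i]) (s t : R) : is_state g -> is_state h ->
  0 < s -> 0 < t -> (forall a, x a = s%:C * g a + t%:C * h a) -> g =1 x.
Proof.
move=> gS hS s0 t0 xE a; pose b := a - x a *: (1 : A).
have [gl g0 g1] := gS; have [hl h0 h1] := hS.
have xb : x b = 0.
  rewrite (scalar_sub (spec_scalar x)) (scalar_scale (spec_scalar x)) spec1.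
  by rewrite mulr1 subrr.
have : x (star b * b) = 0 by rewrite specM xb mulr0.
have sC : 0 < s%:C :> R[i] by rewrite ltcR.
have tC : 0 < t%:C :> R[i] by rewrite ltcR.
rewrite xE => /eqP; rewrite paddr_eq0 ?mulr_ge0 ?(ltW sC) ?(ltW tC)//.
rewrite mulf_eq0 (gt_eqF sC)/= => /andP[/eqP gb _].
have := state_null gS gb; rewrite (scalar_sub gl) (scalar_scale gl) g1 mulr1.
by move/eqP; rewrite subr_eq0 => /eqP.
Qed.

Lemma spec_pure x : is_pure_state x.
Proof.
split; first exact: spec_state.
move=> g h t gS hS /andP[t0 t1] xE; have t'0 : 0 < 1 - t by rewrite subr_gt0.
split; first exact: (spec_extreme gS hS t0 t'0).
by apply: (spec_extreme hS gS t'0 t0) => a; rewrite xE addrC.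
Qed.

End Characters.

(** * Diffuse functionals *)

Section SpecTopology.
Variables (R : realType) (A : cstarType R).
Implicit Types (a g : A) (x y : spec A).

Lemma spec_eval_continuous a : continuous (fun x : spec A => x a : R[i]^o).
Proof.
move=> x.
apply: (@continuous_comp (spec A) {ptws A -> R[i]^o} R[i]^o
  (fun x : spec A => (x : A -> R[i]) : {ptws A -> R[i]^o})
  (fun h : {ptws A -> R[i]^o} => h a)).
  exact: (@initial_continuous (spec A) {ptws A -> R[i]^o}).
exact: (@proj_continuous A (fun=> R[i]^o) a).
Qed.

Lemma Re_continuous : continuous (@complex.Re R : R[i]^o -> R).
Proof.
move=> z; apply/(@cvgrPdist_lt _ _ _ (nbhs z)) => e e0.
have eC : 0 < e%:C :> R[i] by rewrite ltcR.
have /(@cvgrPdist_lt _ _ _ (nbhs z) _ id) /(_ _ eC) :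
    (id : R[i]^o -> R[i]^o) @ z --> z.
  exact: cvg_id.
apply: filterS => w zw; rewrite -ltcR -raddfB; exact: le_lt_trans (normc_ge_Re _) zw.
Qed.

(** The sets where [y g < 1], for positive [g] vanishing at [x], form a filter base, as [g + h]
    refines [g] and [h]. The filter converges pointwise to [x]: take [g = d^* d / e^2] with
    [d = a - x(a)]. *)
Lemma spec_nbhs x (U : set (spec A)) : open U -> U x ->
  exists g, [/\ x g = 0, forall y, 0 <= y g & forall y, y g < 1 -> U y].
Proof.
move=> oU Ux; pose D := [set g | x g = 0 /\ forall y, 0 <= y g].
pose F := filter_from D (fun g => [set y : spec A | y g < 1]).
have FF : Filter F.
  apply: filter_from_filter.
    by exists 0; split => [|y]; rewrite (scalar_zero (spec_scalar _)).
  move=> g h [xg yg] [xh yh]; exists (g + h).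
    split=> [|y]; rewrite (scalar_add (spec_scalar _)) ?xg ?xh ?addr0//.
    by rewrite addr_ge0.
  move=> y /=; rewrite (scalar_add (spec_scalar _)) => ylt; split.
    by apply: le_lt_trans ylt; rewrite lerDl.
  by apply: le_lt_trans ylt; rewrite lerDr.
have : {ptws, (fun y : spec A => y : A -> R[i]^o) @ F --> (x : A -> R[i]^o)}.
  apply/pointwise_cvgP => a.
  apply/(@cvgrPdist_lt _ _ _ _ _ (fun g : A -> R[i]^o => g a)).
  move=> e e0; pose d := a - (x a *: (1 : A) : A).
  have yd y : y d = y a - x a.
    rewrite (scalar_sub (spec_scalar _)) (scalar_scale (spec_scalar _)).
    by rewrite spec1 mulr1.
  pose g := e ^- 2 *: (star d * d).
  have yg y : y g = (`|y a - x a| / e) ^+ 2.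
    by rewrite (scalar_scale (spec_scalar _)) spec_starM yd expr_div_n mulrC.
  exists g.
    split=> [|y]; rewrite yg; first by rewrite subrr normr0 mul0r expr0n.
    by rewrite exprn_ge0// divr_ge0// ltW.
  move=> y /=; rewrite yg expr_lt1 ?divr_ge0// ?(ltW e0)//.
  by rewrite ltr_pdivrMr// mul1r distrC.
have [V oV VU] := oU.
move=> /(_ V) [|g [xg yg] gV].
  by rewrite nbhsE; exists V => //; split => //; move: Ux; rewrite -VU.
by exists g; split => // y yg1; rewrite -VU; exact: gV.
Qed.

Lemma spec_closed1 x : closed [set x].
Proof.
rewrite (_ : [set x] = \bigcap_(a in [set: A]) [set y : spec A | y a = x a]).
  apply: closed_bigI => a _.
  apply: (@preimage_closed _ _ (fun y : spec A => y a : R[i]^o) [set x a]).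
    by move=> y _; exact: spec_eval_continuous.
  exact: (accessible_closed_set1 (hausdorff_accessible (@norm_hausdorff _ R[i]^o))).
apply/seteqP; split => [_ ->//|y yx].
case: y yx => y ys ym; case: x => x xs xm /= yx.
have E : y = x by apply/funext => a; exact: yx.
by move: ys ym {yx}; rewrite E => ys ym; congr Spec; exact: Prop_irrelevance.
Qed.

End SpecTopology.

Section DiffuseSmall.
Variables (R : realType) (A : cstarType R).

Lemma spec_measurable_open (x0 : spec A) (U : set (spec A)) :
  open U -> measurable (U : set (borel_spec x0)).
Proof. by move=> oU; apply: sub_sigma_algebra. Qed.

Lemma spec_measurable1 (x0 x : spec A) :
  measurable ([set x] : set (borel_spec x0)).
Proof.
rewrite -[X in measurable X]setCK; apply: measurableC; apply: spec_measurable_open.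
by rewrite openC; exact: spec_closed1.
Qed.

Lemma spec_measurable_Re (x0 : spec A) (a : A) :
  measurable_fun [set: borel_spec x0] (fun x => complex.Re ((x : spec A) a)).
Proof.
apply: (measurability _ (RGenOpens.measurableE R)).
move=> _ [_ [c [d ->] <-]]; rewrite setTI; apply: spec_measurable_open.
have /continuousP : continuous (fun x : spec A => complex.Re (x a)).
  move=> x; apply: (@continuous_comp _ R[i]^o R (fun x : spec A => x a : R[i]^o)).
    exact: spec_eval_continuous.
  exact: Re_continuous.
by apply; exact: interval_open.
Qed.

(** A point of positive mass would be an atom, its only proper subset being empty. *)
Lemma diffuse_point (x0 : spec A) (mu : {measure set (borel_spec x0) -> \bar R}) x :
  diffuse_measure mu -> mu [set x] = 0%E.
Proof.
move=> dmu; apply: contrapT => mux.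
have mx := @spec_measurable1 x0 x.
apply: (dmu [set x]); split => //.
  by rewrite lt0e measure_ge0 andbT; apply/eqP.
move=> V mV Vx; have [Vx'|nVx] := pselect (V x).
  have -> : V = [set x] by apply/seteqP; split => // _ ->.
  by rewrite ltxx.
have -> : V = set0 by apply/seteqP; split => // y Vy; apply: nVx; rewrite -(Vx y Vy).
by rewrite measure0.
Qed.

(* [f = (1 - g / (|g| + 1))^n] with [g] vanishing at [x] and at least [1] outside a
   neighbourhood of [x] of small measure. *)
Lemma diffuse_small (psi : A -> R[i]) (x : spec A) (e : R) :
  diffuse_functional psi -> 0 < e ->
  exists f : A, [/\ x f = 1, forall y : spec A, 0 <= y f & psi f <= e%:C].
Proof.
move=> /(_ x)[mu [rmu dmu psiE]] e0.
have e20 : 0 < e / 2 by rewrite divr_gt0.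
have mx := @spec_measurable1 x x.
(* Outer regularity at the null set [[set x]]. *)
have [U [oU Ux] muU] : exists2 U : set (spec A),
    open U /\ U x & (mu U < (e / 2)%:E)%E.
  have [infE _] := rmu _ mx.
  have : (ereal_inf [set mu U | U in
      [set U : set (spec A) | open U /\ [set x] `<=` U]] < (e / 2)%:E)%E by rewrite -infE diffuse_point// lte_fin.
  by move=> /ereal_inf_lt[_ [U [oU xU] <-] muU]; exists U => //; split => //; exact: xU.
have [g [xg yg gU]] := spec_nbhs oU Ux.
(* The summand 1 keeps [G] at least 1, so that [eta = 1 - 1 / G], the bound for [h] outside [U],
   satisfies [0 <= eta < 1]. *)
pose G := `|g| + 1; have G0 : 0 < G by rewrite ltr_wpDl.
pose h : A := 1 - G^-1 *: g.
have yh (y : spec A) : y h = 1 - y g / G.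
  rewrite (scalar_sub (spec_scalar _)) (scalar_scale (spec_scalar _)) spec1.
  by rewrite mulrC.
have yG (y : spec A) : y g / G <= 1.
  rewrite ler_pdivrMr// mul1r -(ger0_norm (yg y)) (le_trans (spec_norm_le _ _))//.
  by rewrite lerDl.
have yh0 (y : spec A) : 0 <= y h by rewrite yh subr_ge0.
have yh1 (y : spec A) : y h <= 1 by rewrite yh gerBl divr_ge0// ltW.
pose eta := 1 - complex.Re G^-1.
have GE : (complex.Re G^-1)%:C = G^-1.
  by rewrite RRe_real// ger0_real// invr_ge0 ltW.
have etaE : eta%:C = 1 - G^-1 by rewrite /eta rmorphB -GE.
have G1 : 1 <= G by rewrite lerDr.
have eta0 : 0 <= eta by rewrite -ler0c etaE subr_ge0 invf_le1.
have eta1 : eta < 1 by rewrite -ltcR etaE gtrBl invr_gt0.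
have hU (y : spec A) : ~ U y -> y h <= eta%:C.
  move=> nU; rewrite etaE yh lerD2l lerN2 ler_pdivlMr// mulVf ?gt_eqF//.
  by rewrite real_leNgt ?ger0_real//; apply/negP => /gU.
have fh (n : nat) (y : spec A) : y (h ^+ n) = y h ^+ n.
  elim: n => [|n IH]; first by rewrite !expr0 spec1.
  by rewrite !exprS specM IH.
pose M := fine (mu [set: borel_spec x]).
have ME : mu [set: borel_spec x] = M%:E by rewrite fineK// fin_num_measure.
have M0 : 0 <= M by rewrite fine_ge0.
have [n hn] : exists n, eta ^+ n * M <= e / 2.
  have Rr1 : `|eta| < 1 by rewrite ger0_norm.
  have e1 : 0 < e / 2 / (M + 1) by rewrite divr_gt0// ltr_wpDl.
  have /cvgrPdist_lt/(_ _ e1)[N _ rN] := cvg_expr Rr1.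
  exists N; have := rN N (leqnn N); rewrite /= sub0r normrN ger0_norm ?exprn_ge0//.
  rewrite ltr_pdivlMr ?ltr_wpDl// => /ltW; apply: le_trans.
  by rewrite ler_wpM2l ?exprn_ge0// lerDl.
exists (h ^+ n); split.
- by rewrite fh yh xg mul0r subr0 expr1n.
- by move=> y; rewrite fh exprn_ge0.
have yhE (y : spec A) : y (h ^+ n) = (complex.Re (y (h ^+ n)))%:C.
  by rewrite RRe_real// ger0_real// fh exprn_ge0.
have yf0 (y : spec A) : 0 <= complex.Re (y (h ^+ n)).
  by rewrite -ler0c -yhE fh exprn_ge0.
rewrite psiE /complex_integral.
have -> : \int[mu]_y complex.Im ((y : spec A) (h ^+ n)) = 0.
  rewrite (@eq_Rintegral _ _ _ _ _ (cst 0)) => [|y _]; last by rewrite yhE.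
  by rewrite /Rintegral integral0.
rewrite complexr0 lecR.
(* Pointwise [h^n] is at most the indicator of [U] plus [eta^n]; each contributes at most
   [e / 2]. *)
have intle : (\int[mu]_y (complex.Re ((y : spec A) (h ^+ n)))%:E <= e%:E)%E.
  have mU := @spec_measurable_open x U oU.
  apply: (@le_trans _ _ (\int[mu]_y ((\1_U y)%:E + (eta ^+ n)%:E)))%E.
    apply: ge0_le_integral => //.
    - by move=> y _; rewrite lee_fin.
    - by apply/measurable_EFinP; exact: spec_measurable_Re.
    - apply/measurable_EFinP; apply: measurable_funD => //.
    - move=> y _; rewrite lee_fin -lecR -yhE fh.
      rewrite indicE.
      have [/set_mem Uy|/negP nU] := boolP (y \in U).
        apply: (le_trans (exprn_ile1 _ (yh0 y) (yh1 y))).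
        by rewrite (_ : 1 = 1%:C)// lecR lerDl exprn_ge0.
      rewrite add0r rmorphXn /= lerXn2r ?nnegrE ?ler0c//; apply: hU => Uy.
      by apply: nU; exact: mem_set.
  rewrite ge0_integralD//; first last.
  - by move=> y _; rewrite lee_fin exprn_ge0.
  - by apply/measurable_EFinP; exact: measurable_indic.
  rewrite integral_indic// setIT integral_cst//.
  rewrite [X in (_ * X)%E]ME -EFinM (splitr e) EFinD.
  by rewrite leeD// ?(ltW muU)// lee_fin.
rewrite /Rintegral -lee_fin fineK//.
rewrite ge0_fin_numE ?integral_ge0//; last by move=> y _; rewrite lee_fin.
exact: le_lt_trans intle (ltry _).
Qed.

End DiffuseSmall.

(** * AW*-discretizations *)

Section StarHomTheory.
Variables (R : realType) (A B : cstarType R) (f : starHom A B).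

Lemma starHomM x y : f (x * y) = f x * f y.
Proof. exact: (starHom_monoid f).2. Qed.

Lemma starHom1 : f 1 = 1.
Proof. exact: (starHom_monoid f).1. Qed.

Lemma starHomD x y : f (x + y) = f x + f y.
Proof. by have := starHom_linear f 1 x y; rewrite !scale1r. Qed.

Lemma starHom0 : f 0 = 0.
Proof. by apply: (addrI (f 0)); rewrite -starHomD !addr0. Qed.

Lemma starHomZ k x : f (k *: x) = k *: f x.
Proof. by have := starHom_linear f k x 0; rewrite !addr0 starHom0 addr0. Qed.

Lemma starHom_projection p : projection p -> projection (f p).
Proof. by move=> [pp sp]; split; rewrite -?starHomM -?starHom_star ?pp ?sp. Qed.

End StarHomTheory.

(** * Point masses among the bounded functions *)

Section Points.
Variables (R : realType) (X : Type).

Let delta_bounded (x : X) : (fun y => `[< y = x >]%:R) \in @bounded_pred R X.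
Proof.
by apply/asboolP; exists 1 => y; case: asbool; rewrite ?normr1 ?normr0.
Qed.

Definition delta x : linf_cstar R X := Linf (delta_bounded x).

Lemma delta_projection x : projection (delta x).
Proof.
split.
- apply: (@linfP _ _ (linf_mul (delta x) (delta x))) => y /=.
  by case: asbool; rewrite ?mulr1 ?mulr0.
- apply: (@linfP _ _ (linf_star (delta x))) => y /=.
  by case: asbool; rewrite ?conjc1 ?conjc0.
Qed.

Lemma mul_delta (f : linf_cstar R X) x : f * delta x = (f : linf R X) x *: delta x.
Proof.
apply: (@linfP _ _ (linf_mul f (delta x))
  ((f : linf R X) x *: (delta x : linf R X))) => y.
change ((f : linf R X) y * `[< y = x >]%:R = (f : linf R X) x * `[< y = x >]%:R).
by case: asboolP => [->|_]; rewrite ?mulr0.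
Qed.

Lemma delta_lub : is_proj_lub (range delta) (1 : linf_cstar R X).
Proof.
split => [_ [x _ <-]|||q _ ge].
- exact: delta_projection.
- by split; [rewrite mulr1|exact: star1].
- by move=> s _; rewrite /proj_le mulr1.
rewrite /proj_le mul1r; apply: (@linfP _ _ q (linf_one R X)) => x /=.
have := ge _ (imageT delta x); rewrite /proj_le.
move=> /(congr1 (fun f : linf R X => f x)) /=.
by case: asboolP => // _; rewrite mul1r.
Qed.

(** Pointwise positivity is put in the form [star h * h], which *-homomorphisms transport. *)
Lemma linf_sqrt (f : linf_cstar R X) : (forall x, 0 <= (f : linf R X) x) ->
  exists h : linf_cstar R X, star h * h = f.
Proof.
move=> f0.
have hb : (fun x => sqrtC ((f : linf R X) x)) \in @bounded_pred R X.
  apply/asboolP; exists (sqrtC `|f|) => x.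
  rewrite ger0_norm ?sqrtC_ge0// ler_sqrtC ?nnegrE//.
  by rewrite -(ger0_norm (f0 x)); exact: (linf_norm_ub (f : linf R X)).
exists (Linf hb); apply: (@linfP _ _ (linf_mul (linf_star (Linf hb)) (Linf hb))).
move=> x /=; rewrite -[RHS]sqrtCK expr2; congr (_ * _).
by apply: geC0_conj; rewrite sqrtC_ge0.
Qed.

(** Here preservation of least upper bounds enters: [1 - e] lies above every [u (delta x)], hence
    above their least upper bound [u 1 = 1]. *)
Lemma delta_orthogonal_eq0 (M : awstarType R) (u : awHom (linf_aw R X) M) (e : M) :
  projection e -> (forall x, u (delta x) * e = 0) -> e = 0.
Proof.
move=> [ee se] ue; have [_ _ _ least] := awHom_lub u delta_lub.
have : proj_le (u 1) (1 - e).
  apply: least; first split.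
  - by rewrite mulrBl mul1r mulrBr mulr1 ee subrr subr0.
  - by rewrite starB star1 se.
  - by move=> _ [_ [x _ <-] <-]; rewrite /proj_le mulrBr mulr1 ue subr0.
rewrite /proj_le starHom1 mul1r => /eqP.
by rewrite subr_eq addrC -subr_eq subrr eq_sym => /eqP.
Qed.

End Points.

(** * Vanishing of AW*-discretizations *)

Section Main.
Variables (R : realType) (A : cstarType R).

Lemma relatively_diffuse_orthogonal (C D : csubalg A) (M : awstarType R)
    (phi : starHom A M) (u : awHom (linf_aw R (spec C)) M)
    (v : awHom (linf_aw R (spec D)) M) (x : spec C) (y : spec D) :
  relatively_diffuse C D ->
  (forall c : C, phi (csub_incl C c) = u (gelfand c)) ->
  (forall d : D, phi (csub_incl D d) = v (gelfand d)) ->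
  u (delta R x) * v (delta R y) = 0.
Proof.
move=> CD uC vD; set q := u (delta R x); set p := v (delta R y).
have [qq sq] : projection q by exact/starHom_projection/delta_projection.
have [pp sp] : projection p by exact/starHom_projection/delta_projection.
apply: contrapT => /exists_state[s [[sl s0 s1] sw]].
have sqp : star (q * p) * (q * p) = p * q * p.
  by rewrite starM sq sp mulrA -(mulrA p) qq.
rewrite sqp in sw.
(* Compression by [p] turns [star h * h] into [star (h * p) * (h * p)]. *)
have sub_ge a b : (exists h, star h * h = b - a) -> s (p * a * p) <= s (p * b * p).
  move=> [h hE]; rewrite -subr_ge0 -(scalar_sub sl) -mulrBl -mulrBr -hE.
  by have := s0 (h * p); rewrite starM sp !mulrA.
have sp0 : 0 < s p.
  apply: lt_le_trans sw _; have {3}-> : p = p * 1 * p by rewrite mulr1 pp.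
  apply: sub_ge; exists (1 - q); rewrite starB star1 sq mulrBr mulr1 mulrBl mul1r.
  by rewrite qq subrr subr0.
pose psi a := (s p)^-1 * s (p * phi a * p).
have psiS : is_state psi.
  split.
  - move=> k a b; rewrite /psi starHomD starHomZ mulrDr mulrDl scaleAr scaleAl.
    by rewrite (scalar_add sl) (scalar_scale sl) mulrDr mulrCA.
  - move=> a; apply: mulr_ge0; first by rewrite invr_ge0 ltW.
    have := s0 (phi a * p); rewrite starM sp starHomM starHom_star.
    by rewrite !mulrA.
  - by rewrite /psi starHom1 mulr1 pp mulVf// gt_eqF.
(* By [mul_delta], [phi(d) p = y(d) p]. *)
have psiD (d : D) : psi (csub_incl D d) = y d.
  rewrite /psi vD -mulrA -starHomM mul_delta starHomZ scaleAr pp.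
  by rewrite (scalar_scale sl) mulrCA mulVf ?mulr1// gt_eqF.
have := CD _ (spec_pure y) _ psiS psiD.
set t := s (p * q * p) in sw; pose e := complex.Re (t / s p / 2).
have eE : e%:C = t / s p / 2.
  by rewrite RRe_real// ger0_real// !divr_ge0// ltW.
have e0 : 0 < e by rewrite -ltcR eE !divr_gt0.
move=> /(@diffuse_small _ _ _ x e) /(_ e0) [f [xf f0 psif]].
(* As a bounded function, [f] dominates [delta x], since [f(x) = 1] and [f >= 0]. The choice of [e]
   makes the same quantity at most [t / 2]. *)
have : t <= s (p * phi (csub_incl C f) * p).
  rewrite uC; apply: sub_ge.
  have [|h hE] := @linf_sqrt R (spec C)
    ((gelfand f : linf_cstar R (spec C)) - delta R x).
    move=> z /=; change (0 <= z f - `[< z = x >]%:R).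
    by case: asboolP => [->|_]; rewrite ?xf ?subrr ?subr0.
  exists (u h); rewrite -starHom_star -starHomM hE.
  by rewrite starHomD -scaleN1r starHomZ scaleN1r.
have : s (p * phi (csub_incl C f) * p) <= t / 2.
  move: psif; rewrite /psi eE -(ler_pM2l sp0) mulVKf ?gt_eqF//.
  by rewrite [t / s p / 2]mulrAC mulrC divfK ?gt_eqF.
move=> h1 h2; have := le_trans h2 h1.
by rewrite ler_pdivlMr// mulr_natr mulr2n gerDl => /(lt_le_trans sw); rewrite ltxx.
Qed.

Lemma aw_discretization_zero (C D : csubalg A) (M : awstarType R)
    (phi : starHom A M) :
  cstar_commutative C -> cstar_commutative D -> relatively_diffuse C D ->
  aw_discretization phi -> forall m : M, m = 0.
Proof.
move=> cC cD CD dphi.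
have [u uC] := dphi C cC; have [v vD] := dphi D cD.
have v0 y : v (delta R y) = 0.
  apply: (delta_orthogonal_eq0 (u := u)).
    exact/starHom_projection/delta_projection.
  by move=> x; exact: relatively_diffuse_orthogonal CD uC vD.
have one0 : (1 : M) = 0.
  apply: (delta_orthogonal_eq0 (u := v)) => [|y]; last by rewrite v0 mul0r.
  by split; [rewrite mulr1|exact: star1].
by move=> m; rewrite -(mulr1 m) one0 mulr0.
Qed.

Definition awHom_comp (L M N : awstarType R) (g : awHom M N) (f : awHom L M) :
  awHom L N.
Proof.
exists (starHom_comp g f) => S p /(awHom_lub f) /(awHom_lub g).
by rewrite image_comp.
Defined.

(** Naturality at the inclusion of [C] sends [c] to the image of [eta C c] under [F] of the
    inclusion, and [eta C c = v (gelfand c)]; so [phiC] is that morphism composed with [v]. *)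
Lemma functorial_aw_discretization_unit (F : cstar_aw_functor R)
    (eta : forall B, starHom B (F B)) :
  functorial_aw_discretization eta -> aw_discretization (eta A).
Proof.
move=> [nat_eta [u [v [uK _ _ u_eta]]]] C cC.
exists (awHom_comp (fmap_hom F (csub_incl C)) (v C cC)) => c.
by rewrite nat_eta /= -(u_eta C cC) uK.
Qed.

End Main.

Theorem corollary4p8 (R : realType) (A : cstarType R)
    (hA : exists C D : csubalg A,
      [/\ cstar_commutative C, cstar_commutative D & relatively_diffuse C D]) :
  (forall (M : awstarType R) (phi : starHom A M),
     aw_discretization phi -> forall m : M, m = 0) /\
  (forall (F : cstar_aw_functor R) (eta : forall B : cstarType R, starHom B (F B)),
     functorial_aw_discretization eta -> forall m : F A, m = 0).
Proof.
have [C [D [cC cD CD]]] := hA; split.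
  by move=> M phi; exact: aw_discretization_zero cC cD CD.
move=> F eta hF.
exact: aw_discretization_zero cC cD CD (functorial_aw_discretization_unit hF).
Qed.
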